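(* Let $m,n$ be positive integers and let $G=\mathbb{Z}_m\times\mathbb{Z}_n$. Then any braided monoidal structure on $(\operatorname{Vec}_G,\otimes)$ is tensor equivalent, as a braided monoidal category, to $(\operatorname{Vec}_G^{\Phi_{a,b,d}},\mathcal{R}_{\underline{r}})$ for some $a\in\{0,\ldots,m-1\}$, $b\in\{0,\ldots,(m,n)-1\}$, $d\in\{0,\ldots,n-1\}$ and $\underline{r}\in A_{a,b,d}$.
   Context: Throughout, $k$ is an algebraically closed field of characteristic zero and $k^*=k\setminus\{0\}$. $(m,n)$ denotes the greatest common divisor of $m$ and $n$; $[x]$ denotes the integer part (floor) of a rational number $x$; for each natural number $s$, $\zeta_s\in k$ is a fixed primitive $s$-th root of unity. $g_1$ (resp. $g_2$) is a generator of $\mathbb{Z}_m$ (resp. $\mathbb{Z}_n$), with groups written multiplicatively. A normalized $3$-cocycle on a group $G$ (coefficients in $k^*$ with trivial action) is a map $\Phi:G^3\to k^*$ with $\Phi(y,z,w)\Phi(x,yz,w)\Phi(x,y,z)=\Phi(xy,z,w)\Phi(x,y,zw)$ for all $x,y,z,w\in G$, and with value $1$ whenever one of its arguments is the identity. For $0\le a<m$, $0\le b<(m,n)$, $0\le d<n$, $\Phi_{a,b,d}$ is the normalized $3$-cocycle on $\mathbb{Z}_m\times\mathbb{Z}_n$ given by $$\Phi_{a,b,d}(g_1^ig_2^j,\,g_1^sg_2^t,\,g_1^kg_2^l)=\zeta_m^{a[\frac{k+s}{m}]i}\,\zeta_n^{b[\frac{k+s}{m}]j}\,\zeta_n^{d[\frac{t+l}{n}]j},\qquad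 0\le i,s,k<m,\ 0\le j,t,l<n.$$ A quasi-bicharacter with respect to a normalized $3$-cocycle $\Phi$ on $G$ is a map $\mathcal{R}:G\times G\to k^*$ such that for all $x,y,z\in G$ $$\mathcal{R}(xy,z)=\mathcal{R}(x,z)\mathcal{R}(y,z)\frac{\Phi(z,x,y)\Phi(x,y,z)}{\Phi(x,z,y)},\qquad \mathcal{R}(x,yz)=\mathcal{R}(x,y)\mathcal{R}(x,z)\frac{\Phi(y,x,z)}{\Phi(y,z,x)\Phi(x,y,z)}.$$ $A_{a,b,d}$ is the (possibly empty) set of sequences $\underline{r}=(r_{11},r_{12},r_{21},r_{22})$ of elements of $k^*$ satisfying $$r_{11}^m=\zeta_m^a=\zeta_m^{-a},\quad r_{22}^n=\zeta_n^d=\zeta_n^{-d},\quad r_{12}^n=1,\ r_{12}^m=\zeta_n^{-b},\quad r_{21}^n=1,\ r_{21}^m=\zeta_n^{b}.$$ For $\underline{r}\in A_{a,b,d}$, $\mathcal{R}_{\underline{r}}$ is the (unique) quasi-bicharacter with respect to $\Phi_{a,b,d}$ with $\mathcal{R}_{\underline{r}}(g_u,g_v)=r_{uv}$ for $u,v\in\{1,2\}$; explicitly $\mathcal{R}_{\underline{r}}(g_1^ig_2^j,g_1^sg_2^t)=r_{11}^{is}r_{12}^{it}r_{21}^{js}r_{22}^{jt}$ for $0\le i,s<m$, $0\le j,t<n$. $\operatorname{Vec}_G$ is the category of finite-dimensional $G$-graded $k$-vector spaces with tensor product $(V\otimes W)_g=\bigoplus_{x,y\in G,\,xy=g}V_x\otimes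 W_y$. Monoidal structures on $(\operatorname{Vec}_G,\otimes)$ are parameterized by the normalized $3$-cocycles $\Phi$ on $G$: $\operatorname{Vec}_G^{\Phi}$ denotes the monoidal category whose associativity constraint $(U\otimes V)\otimes W\to U\otimes(V\otimes W)$ is $(u\otimes v)\otimes w\mapsto\Phi(x,y,z)\,u\otimes(v\otimes w)$ for $u\in U_x$, $v\in V_y$, $w\in W_z$, with the usual unit constraints. Braidings on $\operatorname{Vec}_G^{\Phi}$ correspond to quasi-bicharacters $\mathcal{R}$ with respect to $\Phi$, via $U\otimes V\to V\otimes U$, $u\otimes v\mapsto\mathcal{R}(x,y)\,v\otimes u$ for $u\in U_x$, $v\in V_y$; the resulting braided monoidal category is $(\operatorname{Vec}_G^{\Phi},\mathcal{R})$. A braided monoidal structure on $(\operatorname{Vec}_G,\otimes)$ means $(\operatorname{Vec}_G^{\Phi},\mathcal{R})$ for some normalized $3$-cocycle $\Phi$ and some quasi-bicharacter $\mathcal{R}$ with respect to $\Phi$. *)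

(* Defs.v *)
From HB Require Import structures.
From mathcomp Require Import all_boot all_order all_fingroup all_algebra.
From mathcomp Require Import ring.

Set Implicit Arguments.
Unset Strict Implicit.
Unset Printing Implicit Defensive.

Import GroupScope GRing.Theory VectorInternalTheory.
Local Open Scope ring_scope.

Declare Scope cat_scope.
Delimit Scope cat_scope with cat.
Local Open Scope cat_scope.

Reserved Notation "f '\oc' g" (at level 50, left associativity).
Reserved Notation "X '\ox' Y" (at level 45, left associativity).
Reserved Notation "f '\oh' g" (at level 45, left associativity).

Record lincat (k : fieldType) := LinCat {
  obj :> Type;
  hom : obj -> obj -> lmodType k;
  idm : forall X, hom X X;
  comp : forall X Y Z, hom Y Z -> hom X Y -> hom X Z;
  comp_linear_l : forall X Y Z (f : hom X Y), linear (fun g : hom Y Z => comp g f);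
  comp_linear_r : forall X Y Z (g : hom Y Z), linear (fun f : hom X Y => comp g f);
  comp_idl : forall X Y (f : hom X Y), comp (idm Y) f = f;
  comp_idr : forall X Y (f : hom X Y), comp f (idm X) = f;
  compA : forall X Y Z T (h : hom Z T) (g : hom Y Z) (f : hom X Y),
    comp h (comp g f) = comp (comp h g) f
}.
Arguments hom {k l} X Y : rename.
Arguments idm {k l} X : rename.
Arguments comp {k l X Y Z} g f : rename.
Notation "g '\oc' f" := (comp g f) : cat_scope.

Definition is_iso (k : fieldType) (C : lincat k) (X Y : C) (f : hom X Y) : Prop :=
  exists g : hom Y X, g \oc f = idm X /\ f \oc g = idm Y.

Record functor (k : fieldType) (C D : lincat k) := Functor {
  fobj :> C -> D;
  fmap : forall X Y, hom X Y -> hom (fobj X) (fobj Y);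
  fmap_linear : forall X Y, linear (@fmap X Y);
  fmap_id : forall X, fmap (idm X) = idm (fobj X);
  fmap_comp : forall X Y Z (g : hom Y Z) (f : hom X Y),
    fmap (g \oc f) = fmap g \oc fmap f
}.
Arguments fmap {k C D} f {X Y} : rename.

Definition is_equivalence (k : fieldType) (C D : lincat k) (F : functor C D) : Prop :=
  exists H : functor D C,
    (exists eta : forall X : C, hom X (H (F X)),
        (forall X, is_iso (eta X)) /\
        (forall X Y (f : hom X Y), eta Y \oc f = fmap H (fmap F f) \oc eta X)) /\
    (exists eps : forall X : D, hom (F (H X)) X,
        (forall X, is_iso (eps X)) /\
        (forall X Y (f : hom X Y), eps Y \oc fmap F (fmap H f) = f \oc eps X)).

Record moncat (k : fieldType) := MonCat {
  mcat :> lincat k;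
  tobj : mcat -> mcat -> mcat;
  thom : forall X X' Y Y' : mcat,
    hom X X' -> hom Y Y' -> hom (tobj X Y) (tobj X' Y');
  tunit : mcat;
  assoc : forall X Y Z, hom (tobj (tobj X Y) Z) (tobj X (tobj Y Z));
  assoc_inv : forall X Y Z, hom (tobj X (tobj Y Z)) (tobj (tobj X Y) Z);
  lunit : forall X, hom (tobj tunit X) X;
  runit : forall X, hom (tobj X tunit) X;
  thom_linear_l : forall X X' Y Y' (g : hom Y Y'),
    linear (fun f : hom X X' => thom f g);
  thom_linear_r : forall X X' Y Y' (f : hom X X'),
    linear (fun g : hom Y Y' => thom f g);
  thom_id : forall X Y, thom (idm X) (idm Y) = idm (tobj X Y);
  thom_comp : forall X X' X'' Y Y' Y''
      (f' : hom X' X'') (f : hom X X') (g' : hom Y' Y'') (g : hom Y Y'),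
    thom (f' \oc f) (g' \oc g) = thom f' g' \oc thom f g;
  assoc_natural : forall X X' Y Y' Z Z'
      (f : hom X X') (g : hom Y Y') (h : hom Z Z'),
    assoc X' Y' Z' \oc thom (thom f g) h = thom f (thom g h) \oc assoc X Y Z;
  assocK : forall X Y Z, assoc_inv X Y Z \oc assoc X Y Z = idm _;
  assoc_invK : forall X Y Z, assoc X Y Z \oc assoc_inv X Y Z = idm _;
  lunit_iso : forall X, is_iso (lunit X);
  lunit_natural : forall X Y (f : hom X Y),
    lunit Y \oc thom (idm tunit) f = f \oc lunit X;
  runit_iso : forall X, is_iso (runit X);
  runit_natural : forall X Y (f : hom X Y),
    runit Y \oc thom f (idm tunit) = f \oc runit X;
  triangle : forall X Y,
    thom (idm X) (lunit Y) \oc assoc X tunit Y = thom (runit X) (idm Y);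
  pentagon : forall X Y Z T,
    thom (idm X) (assoc Y Z T) \oc assoc X (tobj Y Z) T
      \oc thom (assoc X Y Z) (idm T) =
    assoc X Y (tobj Z T) \oc assoc (tobj X Y) Z T
}.
Arguments tobj {k m} X Y : rename.
Arguments thom {k m X X' Y Y'} f g : rename.
Arguments tunit {k m} : rename.
Arguments assoc {k m} X Y Z : rename.
Arguments assoc_inv {k m} X Y Z : rename.
Arguments lunit {k m} X : rename.
Arguments runit {k m} X : rename.
Notation "X '\ox' Y" := (tobj X Y) : cat_scope.
Notation "f '\oh' g" := (thom f g) : cat_scope.

Record brcat (k : fieldType) := BrCat {
  bmcat :> moncat k;
  braid : forall X Y : bmcat, hom (X \ox Y) (Y \ox X);
  braid_iso : forall X Y, is_iso (braid X Y);
  braid_natural : forall X X' Y Y' (f : hom X X') (g : hom Y Y'),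
    braid X' Y' \oc (f \oh g) = (g \oh f) \oc braid X Y;
  hexagon1 : forall X Y Z : bmcat,
    assoc Y Z X \oc braid X (Y \ox Z) \oc assoc X Y Z =
    (idm Y \oh braid X Z) \oc assoc Y X Z \oc (braid X Y \oh idm Z);
  hexagon2 : forall X Y Z : bmcat,
    assoc_inv Z X Y \oc braid (X \ox Y) Z \oc assoc_inv X Y Z =
    (braid X Z \oh idm Y) \oc assoc_inv X Z Y \oc (idm X \oh braid Y Z)
}.
Arguments braid {k b} X Y : rename.

Record monfunctor (k : fieldType) (C D : moncat k) := MonFunctor {
  mfun :> functor C D;
  phi2 : forall X Y : C, hom (mfun X \ox mfun Y) (mfun (X \ox Y));
  phi0 : hom tunit (mfun tunit);
  phi2_iso : forall X Y, is_iso (phi2 X Y);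
  phi0_iso : is_iso phi0;
  phi2_natural : forall X X' Y Y' (f : hom X X') (g : hom Y Y'),
    phi2 X' Y' \oc (fmap mfun f \oh fmap mfun g) = fmap mfun (f \oh g) \oc phi2 X Y;
  phi2_assoc : forall X Y Z : C,
    fmap mfun (assoc X Y Z) \oc phi2 (X \ox Y) Z \oc (phi2 X Y \oh idm (mfun Z)) =
    phi2 X (Y \ox Z) \oc (idm (mfun X) \oh phi2 Y Z)
      \oc assoc (mfun X) (mfun Y) (mfun Z);
  phi2_lunit : forall X : C,
    fmap mfun (lunit X) \oc phi2 tunit X \oc (phi0 \oh idm (mfun X)) = lunit (mfun X);
  phi2_runit : forall X : C,
    fmap mfun (runit X) \oc phi2 X tunit \oc (idm (mfun X) \oh phi0) = runit (mfun X)
}.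
Arguments phi2 {k C D} m X Y : rename.
Arguments phi0 {k C D} m : rename.

Definition is_braided (k : fieldType) (C D : brcat k) (F : monfunctor C D) : Prop :=
  forall X Y : C,
    fmap F (braid X Y) \oc phi2 F X Y = phi2 F Y X \oc braid (F X) (F Y).

Definition braided_equivalent (k : fieldType) (C D : brcat k) : Prop :=
  exists F : monfunctor C D, is_braided F /\ is_equivalence F.

(* MathComp has no tensor product of abstract vector spaces. In the coordinates
   of [v2r], V (x) W is the space of (dim V) x (dim W) matrices and u (x) w the
   rank one matrix u^T w; [tlift] is its universal property. *)
Section Tensor.
Variable k : fieldType.
Implicit Types V W U T : vectType k.

Definition tensv V W : vectType k := 'M[k]_(dim V, dim W).

Definition tens V W (u : V) (w : W) : tensv V W := (v2r u)^T *m v2r w.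

Definition bvec V (i : 'I_(dim V)) : V := r2v (delta_mx 0 i).

Definition tlift V W U (b : V -> W -> U) : 'Hom(tensv V W, U) :=
  linfun (fun t : tensv V W =>
    \sum_i \sum_j (t : 'M[k]_(dim V, dim W)) i j *: b (bvec i) (bvec j)).

Definition bilin V W U (b : V -> W -> U) : Prop :=
  (forall w, linear (fun v => b v w)) /\ (forall v, linear (b v)).

Definition tensvs V W (A : {vspace V}) (B : {vspace W}) : {vspace tensv V W} :=
  <<[seq tens a b | a <- vbasis A, b <- vbasis B]>>%VS.

Lemma bvec_sum V (v : V) : v = \sum_i v2r v 0 i *: bvec i.
Proof.
apply: (can_inj v2rK); rewrite linear_sum {1}[v2r v]row_sum_delta.
by apply: eq_bigr => i _; rewrite linearZ /= r2vK.
Qed.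

Lemma tens_bilin V W : bilin (@tens V W).
Proof.
split=> [w a u v|v a u w]; rewrite /tens linearP /=.
  by rewrite linearP /= mulmxDl scalemxAl.
by rewrite mulmxDr scalemxAr.
Qed.

Lemma tlift_fun_linear V W U (b : V -> W -> U) :
  linear (fun t : tensv V W =>
    \sum_i \sum_j (t : 'M[k]_(dim V, dim W)) i j *: b (bvec i) (bvec j)).
Proof.
move=> a s t; rewrite scaler_sumr -big_split /=; apply: eq_bigr => i _.
rewrite scaler_sumr -big_split /=; apply: eq_bigr => j _.
by rewrite !mxE scalerDl scalerA.
Qed.

Lemma linear_sumE V W (f : V -> W) (I : Type) (r : seq I) (P : pred I) (c : I -> k) v :
  linear f -> f (\sum_(i <- r | P i) c i *: v i) = \sum_(i <- r | P i) c i *: f (v i).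
Proof.
move=> fL; pose F : {linear V -> W} := HB.pack f (GRing.isLinear.Build k V W *:%R f fL).
rewrite -[f]/(F : V -> W) linear_sum; by apply: eq_bigr => i _; rewrite linearZ.
Qed.

Lemma linfunE V W (f : V -> W) : linear f -> linfun f =1 f.
Proof.
move=> fL v; pose F : {linear V -> W} := HB.pack f (GRing.isLinear.Build k V W *:%R f fL).
by rewrite (lfunE F).
Qed.

Lemma v2r_bvec V (i : 'I_(dim V)) : v2r (bvec i) = delta_mx 0 i.
Proof. exact: r2vK. Qed.

Lemma tens0l V W (w : W) : tens (0 : V) w = 0.
Proof. by rewrite /tens linear0 trmx0 mul0mx. Qed.

Lemma tens0r V W (v : V) : tens v (0 : W) = 0.
Proof. by rewrite /tens linear0 mulmx0. Qed.

Lemma tensZl V W (c : k) (v : V) (w : W) : tens (c *: v) w = c *: tens v w.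
Proof. by rewrite -[c *: v]addr0 (tens_bilin _ _).1 tens0l addr0. Qed.

Lemma tensZr V W (c : k) (v : V) (w : W) : tens v (c *: w) = c *: tens v w.
Proof. by rewrite -[c *: w]addr0 (tens_bilin _ _).2 tens0r addr0. Qed.

Lemma tens_bvec V W (t : tensv V W) :
  t = \sum_i \sum_j (t : 'M[k]_(dim V, dim W)) i j *: tens (bvec i) (bvec j).
Proof.
rewrite [LHS](matrix_sum_delta t); apply: eq_bigr => i _; apply: eq_bigr => j _.
by rewrite /tens !v2r_bvec trmx_delta mul_delta_mx.
Qed.

Lemma tlift_tens V W U (b : V -> W -> U) : bilin b ->
  forall v w, tlift b (tens v w) = b v w.
Proof.
move=> [bl br] v w; rewrite linfunE; last exact: tlift_fun_linear.
rewrite [in RHS](bvec_sum v) (linear_sumE _ _ _ _ (bl w)).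
apply: eq_bigr => i _; rewrite [in RHS](bvec_sum w) (linear_sumE _ _ _ _ (br _)).
rewrite scaler_sumr; apply: eq_bigr => j _.
by rewrite scalerA /tens mxE big_ord1 mxE.
Qed.

Lemma tens_ext V W U (f g : 'Hom(tensv V W, U)) :
  (forall v w, f (tens v w) = g (tens v w)) -> f = g.
Proof.
move=> fg; apply/lfunP => t; rewrite (tens_bvec t) !linear_sum.
apply: eq_bigr => i _; rewrite !linear_sum; apply: eq_bigr => j _.
by rewrite !linearZ /= fg.
Qed.

Lemma mem_tensvs V W (A : {vspace V}) (B : {vspace W}) a b :
  a \in A -> b \in B -> tens a b \in tensvs A B.
Proof.
move=> aA bB; rewrite (coord_vbasis aA) (coord_vbasis bB).
rewrite (linear_sumE _ _ _ _ ((@tens_bilin V W).1 _)).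
apply: memv_suml => i _; apply: memvZ.
rewrite (linear_sumE _ _ _ _ ((@tens_bilin V W).2 _)).
apply: memv_suml => j _; apply: memvZ; apply: memv_span.
by apply: allpairs_f; apply: mem_nth; rewrite size_tuple.
Qed.

Lemma tensvs_sub V W (A : {vspace V}) (B : {vspace W}) (S : {vspace tensv V W}) :
  (forall a b, a \in A -> b \in B -> tens a b \in S) -> (tensvs A B <= S)%VS.
Proof.
move=> H; apply/span_subvP => _ /allpairsP[[a b] /= [aA bB ->]].
by apply: H; apply: vbasis_mem.
Qed.

End Tensor.

Section Graded.
Variables (k : fieldType) (gT : finGroupType).

Record grspace := GrSpace {
  gsp :> vectType k;
  gpart : gT -> {vspace gsp};
  gpart_full : (\sum_x gpart x)%VS = fullv;
  gpart_direct : directv (\sum_x gpart x)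
}.

Implicit Types V W U : grspace.

Definition gproj (V : grspace) (x : gT) : 'End(V) := sumv_pi_for (esym (gpart_full V)) x.

Lemma gproj_mem V x v : gproj V x v \in gpart V x.
Proof. exact: memv_sum_pi. Qed.

Lemma gproj_sum V v : \sum_x gproj V x v = v.
Proof. exact: sumv_pi_sum (memvf _). Qed.

Lemma gpart_uniq V (u v : gT -> V) :
  (forall x, u x \in gpart V x) -> (forall x, v x \in gpart V x) ->
  \sum_x u x = \sum_x v x -> u =1 v.
Proof.
move=> hu hv e x.
have /directv_sum_unique := gpart_direct V.
move/(_ u v (fun x _ => hu x) (fun x _ => hv x)); rewrite e eqxx.
by move/esym/forall_inP/(_ x isT)/eqP.
Qed.

Lemma gproj_hom V x y v : v \in gpart V x -> gproj V y v = if y == x then v else 0.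
Proof.
move=> vx; move: y; apply: gpart_uniq => [y|y|]; first exact: gproj_mem.
  by case: eqP => [->//|_]; apply: mem0v.
by rewrite gproj_sum -big_mkcond big_pred1_eq.
Qed.

Definition gpred V W : {pred 'Hom(V, W)} :=
  fun f => [forall x, (f @: gpart V x <= gpart W x)%VS].

Arguments gpred : clear implicits.

Lemma gpredP V W (f : 'Hom(V, W)) :
  reflect (forall x v, v \in gpart V x -> f v \in gpart W x) (f \in gpred V W).
Proof.
apply: (iffP forallP) => [H x v vx|H x].
  by apply: (subvP (H x)); apply: memv_img.
by apply/subvP => _ /memv_imgP[v vx ->]; apply: H.
Qed.

Lemma gpred_submod V W : submod_closed (gpred V W).
Proof.
split=> [|a f g /gpredP hf /gpredP hg]; apply/gpredP => x v vx.
  by rewrite lfunE mem0v.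
by rewrite add_lfunE scale_lfunE memvD ?memvZ ?hf ?hg.
Qed.

HB.instance Definition _ V W :=
  GRing.isSubmodClosed.Build k 'Hom(V, W) (gpred V W) (gpred_submod V W).

Record ghom (V W : grspace) := GHom {
  gval :> 'Hom(V, W);
  gvalP : gval \in gpred V W
}.
HB.instance Definition _ V W := [isSub for @gval V W].
HB.instance Definition _ V W := [Choice of ghom V W by <:].
HB.instance Definition _ V W := [SubChoice_isSubLmodule of ghom V W by <:].

Lemma ghom_inj V W (f g : ghom V W) : gval f =1 gval g -> f = g.
Proof. by move=> fg; apply/val_inj/lfunP. Qed.

Lemma ghom_mem V W (f : ghom V W) x v : v \in gpart V x -> f v \in gpart W x.
Proof. by move: x v; apply/gpredP/gvalP. Qed.

Lemma gproj_ext V (T : vectType k) (F G : V -> T) : linear F -> linear G ->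
  (forall x v, v \in gpart V x -> F v = G v) -> F =1 G.
Proof.
move=> FL GL FG v; rewrite -(gproj_sum v) (eq_bigr (fun x => 1 *: gproj V x v)); last first.
  by move=> x _; rewrite scale1r.
rewrite !linear_sumE //; apply: eq_bigr => x _; congr (_ *: _); apply: FG.
exact: gproj_mem.
Qed.

Lemma gid_subproof V : \1%VF \in gpred V V.
Proof. by apply/gpredP => x v; rewrite id_lfunE. Qed.
Definition gid V : ghom V V := GHom (gid_subproof V).

Lemma gcomp_subproof U V W (g : ghom V W) (f : ghom U V) : (g \o f)%VF \in gpred U W.
Proof. by apply/gpredP => x v vx; rewrite comp_lfunE !ghom_mem. Qed.
Definition gcomp U V W (g : ghom V W) (f : ghom U V) : ghom U W :=
  GHom (gcomp_subproof g f).

Lemma gidE V v : gid V v = v. Proof. exact: id_lfunE. Qed.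
Lemma gcompE U V W (g : ghom V W) (f : ghom U V) u : gcomp g f u = g (f u).
Proof. exact: comp_lfunE. Qed.
Lemma glinE V W a (f g : ghom V W) v : (a *: f + g) v = a *: f v + g v.
Proof. by rewrite /= add_lfunE scale_lfunE. Qed.

Lemma gcomp_linear_l U V W (f : ghom U V) : linear (fun g : ghom V W => gcomp g f).
Proof. by move=> a g h; apply: ghom_inj => u; rewrite !(glinE, gcompE). Qed.

Lemma gcomp_linear_r U V W (g : ghom V W) : linear (fun f : ghom U V => gcomp g f).
Proof. by move=> a f h; apply: ghom_inj => u; rewrite !(glinE, gcompE) linearP. Qed.

Lemma gcomp_idl V W (f : ghom V W) : gcomp (gid W) f = f.
Proof. by apply: ghom_inj => v; rewrite gcompE gidE. Qed.

Lemma gcomp_idr V W (f : ghom V W) : gcomp f (gid V) = f.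
Proof. by apply: ghom_inj => v; rewrite gcompE gidE. Qed.

Lemma gcompA U V W T (h : ghom W T) (g : ghom V W) (f : ghom U V) :
  gcomp h (gcomp g f) = gcomp (gcomp h g) f.
Proof. by apply: ghom_inj => v; rewrite !gcompE. Qed.

Definition gcat : lincat k :=
  @LinCat k grspace (fun V W => ghom V W) gid gcomp
    gcomp_linear_l gcomp_linear_r gcomp_idl gcomp_idr gcompA.

Definition gtpart V W (g : gT) : {vspace tensv V W} :=
  (\sum_(p : gT * gT | (p.1 * p.2)%g == g) tensvs (gpart V p.1) (gpart W p.2))%VS.

Lemma mem_gtpart V W x y v w : v \in gpart V x -> w \in gpart W y ->
  tens v w \in gtpart V W (x * y)%g.
Proof.
move=> vx wy; apply: (subvP (sumv_sup (x, y) _ (subvv _))) => //=.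
exact: mem_tensvs.
Qed.

Lemma gtpart_mem V W (T : vectType k) (F : tensv V W -> T) (S : {vspace T}) g :
  linear F ->
  (forall x y v w, (x * y)%g = g -> v \in gpart V x -> w \in gpart W y ->
     F (tens v w) \in S) ->
  forall t, t \in gtpart V W g -> F t \in S.
Proof.
move=> FL H t tg; rewrite -(linfunE FL) memv_preim; move: t tg; apply/subvP.
apply/subv_sumP => -[x y] /= /eqP xyg; apply: tensvs_sub => v w vx wy.
by rewrite -memv_preim linfunE //; apply: (H x y).
Qed.

Lemma lin_sumf (V W : vectType k) (I : Type) (r : seq I) (F : I -> V -> W) :
  (forall i, linear (F i)) -> linear (fun v => \sum_(i <- r) F i v).
Proof.
move=> FL a u v; rewrite scaler_sumr -big_split; apply: eq_bigr => i _; exact: FL.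
Qed.

Lemma lin_scalef (V W : vectType k) (F : V -> W) c : linear F -> linear (fun v => c *: F v).
Proof. by move=> FL a u v; rewrite FL scalerDr !scalerA mulrC. Qed.

Lemma lin_comp (U V W : vectType k) (F : V -> W) (G : U -> V) :
  linear F -> linear G -> linear (fun u => F (G u)).
Proof. by move=> FL GL a u v; rewrite GL FL. Qed.

Lemma lin_sub (V W : vectType k) (F G : V -> W) :
  linear F -> linear G -> linear (fun v => F v - G v).
Proof. by move=> FL GL a u v; rewrite FL GL scalerBr opprD addrACA. Qed.

Lemma lin_fun (V W : vectType k) (f : 'Hom(V, W)) : linear f.
Proof. exact: linearP. Qed.

Lemma lin_id (V : vectType k) : linear (fun v : V => v).
Proof. by []. Qed.

Lemma lin_tensl (V W : vectType k) (w : W) : linear (fun v : V => tens v w).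
Proof. exact: (tens_bilin V W).1. Qed.

Lemma lin_tensr (V W : vectType k) (v : V) : linear (fun w : W => tens v w).
Proof. exact: (tens_bilin V W).2. Qed.

Lemma lin_tlift (U V W T : vectType k) (b : U -> V -> W -> T) t :
  (forall v w, linear (fun u => b u v w)) -> linear (fun u => tlift (b u) t).
Proof.
move=> bL a u u'; rewrite !linfunE; try exact: tlift_fun_linear.
rewrite scaler_sumr -big_split; apply: eq_bigr => i _ /=.
rewrite scaler_sumr -big_split; apply: eq_bigr => j _ /=.
by rewrite bL scalerDr !scalerA mulrC.
Qed.

Lemma gtpart_eq V W (T : vectType k) (F G : tensv V W -> T) g :
  linear F -> linear G ->
  (forall x y v w, (x * y)%g = g -> v \in gpart V x -> w \in gpart W y ->
     F (tens v w) = G (tens v w)) ->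
  forall t, t \in gtpart V W g -> F t = G t.
Proof.
move=> FL GL FG t tg; apply/eqP; rewrite -subr_eq0 -memv0.
apply: (gtpart_mem (F := fun t => F t - G t) (lin_sub FL GL)) tg => x y v w xy vx wy.
by rewrite (FG _ _ _ _ xy vx wy) subrr mem0v.
Qed.

Definition tmap (V W V' W' : vectType k) (f : 'Hom(V, V')) (g : 'Hom(W, W')) :
    'Hom(tensv V W, tensv V' W') :=
  tlift (fun v w => tens (f v) (g w)).

Lemma tmapE (V W V' W' : vectType k) (f : 'Hom(V, V')) (g : 'Hom(W, W')) v w :
  tmap f g (tens v w) = tens (f v) (g w).
Proof.
rewrite tlift_tens //; split=> u.
  exact: (lin_comp (F := fun v' => tens v' (g u)) (@lin_tensl _ _ _) (@lin_fun _ _ _)).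
exact: (lin_comp (F := fun w' => tens (f u) w') (@lin_tensr _ _ _) (@lin_fun _ _ _)).
Qed.

Lemma gtpart_full V W : (\sum_g gtpart V W g)%VS = fullv.
Proof.
apply/eqP; rewrite eqEsubv subvf; apply/subvP => t _.
have mem v w : tens v w \in (\sum_g gtpart V W g)%VS.
  rewrite -(gproj_sum v) -(gproj_sum w).
  rewrite (eq_bigr (fun x => 1 *: gproj V x v)) => [|x _]; last by rewrite scale1r.
  rewrite (linear_sumE _ _ _ _ (@lin_tensl _ _ _)).
  apply: memv_suml => x _; apply: memvZ.
  rewrite (eq_bigr (fun x => 1 *: gproj W x w)) => [|y _]; last by rewrite scale1r.
  rewrite (linear_sumE _ _ _ _ (@lin_tensr _ _ _)).
  apply: memv_suml => y _; apply: memvZ.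
  apply: (subvP (sumv_sup (x * y)%g _ (subvv _))) => //.
  by apply: mem_gtpart; apply: gproj_mem.
rewrite (tens_bvec t); apply: memv_suml => i _; apply: memv_suml => j _.
exact: memvZ.
Qed.

(* [directv] would see through [gtpart] to the inner sum: hence the variable [D]. *)
Lemma gtpart_direct V W (D : gT -> {vspace tensv V W}) :
  D = gtpart V W -> directv (\sum_g D g).
Proof.
move=> defD.
pose P g : 'End(tensv V W) := \sum_(p : gT * gT | (p.1 * p.2)%g == g)
  tmap (gproj V p.1) (gproj W p.2).
have PE g h t : t \in D h -> P g t = if g == h then t else 0.
  rewrite defD; move: t; apply: gtpart_eq; first exact: lin_fun.
    by case: (g == h) => a u v; rewrite ?scaler0 ?addr0.
  move=> x y v w <- vx wy; rewrite sum_lfunE big_mkcond (bigD1 (x, y)) //= big1 => [|[x' y']].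
    by rewrite addr0 tmapE (gproj_hom _ vx) (gproj_hom _ wy) !eqxx eq_sym.
  rewrite xpair_eqE negb_and /= tmapE (gproj_hom _ vx) (gproj_hom _ wy).
  by case/orP => /negPf->; rewrite ?tens0l ?tens0r if_same.
apply/directv_sum_independent => u uU u0 g _.
have := congr1 (P g) u0; rewrite linear0 linear_sum (bigD1 g) //= big1 => [|h hg].
  by rewrite addr0 (PE g g) ?eqxx // uU.
by rewrite (PE g h) ?uU // eq_sym (negPf hg).
Qed.

Definition gtens V W : grspace := GrSpace (gtpart_full V W) (gtpart_direct (erefl (gtpart V W))).

Lemma gpred_tens V W U (f : 'Hom(gtens V W, U)) :
  (forall x y v w, v \in gpart V x -> w \in gpart W y ->
     f (tens v w) \in gpart U (x * y)%g) -> f \in gpred (gtens V W) U.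
Proof.
move=> H; apply/gpredP => g t; apply: gtpart_mem; first exact: lin_fun.
by move=> x y v w <- vx wy; apply: (H x y).
Qed.

Lemma ext2 V W (T : vectType k) (f g : 'Hom(gtens V W, T)) :
  (forall x y v w, v \in gpart V x -> w \in gpart W y -> f (tens v w) = g (tens v w)) ->
  f =1 g.
Proof.
move=> H; apply: gproj_ext; try exact: lin_fun.
move=> z t; apply: gtpart_eq; try exact: lin_fun.
by move=> x y v w _ vx wy; apply: (H x y).
Qed.

Lemma ext3 U V W (T : vectType k) (f g : 'Hom(gtens (gtens U V) W, T)) :
  (forall x y z u v w, u \in gpart U x -> v \in gpart V y -> w \in gpart W z ->
    f (tens (tens u v) w : tensv (tensv U V) W) = g (tens (tens u v) w : tensv (tensv U V) W)) ->
  f =1 g.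
Proof.
move=> H; apply: ext2 => xy z t w tg wz; move: t tg.
apply: gtpart_eq; try exact: (lin_comp (@lin_fun _ _ _) (@lin_tensl _ _ _)).
by move=> x y u v _ ux vy; apply: (H x y z).
Qed.

Lemma ext3r U V W (T : vectType k) (f g : 'Hom(gtens U (gtens V W), T)) :
  (forall x y z u v w, u \in gpart U x -> v \in gpart V y -> w \in gpart W z ->
    f (tens u (tens v w) : tensv U (tensv V W)) = g (tens u (tens v w) : tensv U (tensv V W))) ->
  f =1 g.
Proof.
move=> H; apply: ext2 => x yz u t ux; move: t.
apply: gtpart_eq; try exact: (lin_comp (@lin_fun _ _ _) (@lin_tensr _ _ _)).
by move=> y z v w _ vy wz; apply: (H x y z).
Qed.

Lemma ext4 U V W X (T : vectType k) (f g : 'Hom(gtens (gtens (gtens U V) W) X, T)) :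
  (forall x y z t u v w s, u \in gpart U x -> v \in gpart V y -> w \in gpart W z ->
    s \in gpart X t ->
    f (tens (tens (tens u v) w) s : tensv (tensv (tensv U V) W) X) =
    g (tens (tens (tens u v) w) s : tensv (tensv (tensv U V) W) X)) ->
  f =1 g.
Proof.
move=> H; apply: ext3 => xy z q t w s tg wz sq; move: t tg.
apply: gtpart_eq;
  try exact: (lin_comp (@lin_fun _ _ _) (lin_comp (@lin_tensl _ _ _) (@lin_tensl _ _ _))).
by move=> x y u v _ ux vy; apply: (H x y z q).
Qed.

Lemma gthom_subproof V V' W W' (f : ghom V V') (g : ghom W W') :
  (tmap f g : 'Hom(gtens V W, gtens V' W')) \in gpred (gtens V W) (gtens V' W').
Proof.
apply: gpred_tens => x y v w vx wy.
by rewrite tmapE; apply: mem_gtpart; apply: ghom_mem.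
Qed.

Definition gthom V V' W W' (f : ghom V V') (g : ghom W W') :
    ghom (gtens V W) (gtens V' W') := GHom (gthom_subproof f g).

Lemma gthomE V V' W W' (f : ghom V V') (g : ghom W W') v w :
  gthom f g (tens v w : tensv V W) = tens (f v) (g w).
Proof. exact: tmapE. Qed.

Definition gupart (x : gT) : {vspace k^o} := if x == 1%g then fullv else 0%VS.

Lemma gupart_full : (\sum_x gupart x)%VS = fullv.
Proof.
apply/eqP; rewrite eqEsubv subvf (sumv_sup 1%g) //.
by rewrite /gupart eqxx.
Qed.

Lemma gupart_direct : directv (\sum_x gupart x).
Proof.
apply/directv_sum_independent => u uU u0 x _.
have U0 y : y != 1%g -> u y = 0.
  by move=> /negPf y1; have := uU y isT; rewrite /gupart y1 memv0 => /eqP.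
case: (eqVneq x 1%g) => [->|/U0 //].
by move: u0; rewrite (bigD1 1%g) //= big1 ?addr0.
Qed.

Definition gunit : grspace := GrSpace gupart_full gupart_direct.

Lemma gunit_deg x (c : k^o) : c \in gpart gunit x -> c = 0 \/ x = 1%g.
Proof.
rewrite /= /gupart; case: eqP => [->|_]; first by right.
by rewrite memv0 => /eqP; left.
Qed.

Record cocycle3 := Cocycle3 {
  cocycle3_fun :> gT -> gT -> gT -> k;
  cocycle3_neq0 : forall x y z, cocycle3_fun x y z != 0;
  cocycle3E : forall x y z w,
    cocycle3_fun y z w * cocycle3_fun x (y * z)%g w * cocycle3_fun x y z =
    cocycle3_fun (x * y)%g z w * cocycle3_fun x y (z * w)%g;
  cocycle3_1l : forall y z, cocycle3_fun 1%g y z = 1;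
  cocycle3_1m : forall x z, cocycle3_fun x 1%g z = 1;
  cocycle3_1r : forall x y, cocycle3_fun x y 1%g = 1
}.

Record quasibichar (Phi : cocycle3) := QuasiBichar {
  quasibichar_fun :> gT -> gT -> k;
  quasibichar_neq0 : forall x y, quasibichar_fun x y != 0;
  quasibicharMl : forall x y z, quasibichar_fun (x * y)%g z =
    quasibichar_fun x z * quasibichar_fun y z *
      (Phi z x y * Phi x y z / Phi x z y);
  quasibicharMr : forall x y z, quasibichar_fun x (y * z)%g =
    quasibichar_fun x y * quasibichar_fun x z *
      (Phi y x z / (Phi y z x * Phi x y z))
}.

(* On homogeneous vectors u, v, w of degrees x, y, z these maps are
   (u (x) v) (x) w |-> c x y z . u (x) (v (x) w), its analogue backwards, and
   v (x) w |-> r x y . w (x) v: see [assoc_lfE], [assoc_inv_lfE], [braid_lfE]. *)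
Definition assoc_lf (c : gT -> gT -> gT -> k) U V W :
    'Hom(gtens (gtens U V) W, gtens U (gtens V W)) :=
  tlift (fun (t : tensv U V) (w : W) => tlift (fun (u : U) (v : V) =>
    \sum_x \sum_y \sum_z
      c x y z *: tens (gproj U x u) (tens (gproj V y v) (gproj W z w))) t).

Definition assoc_inv_lf (c : gT -> gT -> gT -> k) U V W :
    'Hom(gtens U (gtens V W), gtens (gtens U V) W) :=
  tlift (fun (u : U) (t : tensv V W) => tlift (fun (v : V) (w : W) =>
    \sum_x \sum_y \sum_z
      c x y z *: tens (tens (gproj U x u) (gproj V y v)) (gproj W z w)) t).

Definition braid_lf (r : gT -> gT -> k) V W : 'Hom(gtens V W, gtens W V) :=
  tlift (fun (v : V) (w : W) =>
    \sum_x \sum_y r x y *: tens (gproj W y w) (gproj V x v)).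

Definition lunit_lf V : 'Hom(gtens gunit V, V) :=
  tlift (fun (c : k^o) (v : V) => c *: v).

Definition runit_lf V : 'Hom(gtens V gunit, V) :=
  tlift (fun (v : V) (c : k^o) => c *: v).

Lemma sum1_gproj V x v (T : vectType k) (F : gT -> V -> T) :
  v \in gpart V x -> (forall y, F y 0 = 0) -> \sum_y F y (gproj V y v) = F x v.
Proof.
move=> vx F0; rewrite (bigD1 x) //= big1 => [|y yx].
  by rewrite addr0 (gproj_hom _ vx) eqxx.
by rewrite (gproj_hom _ vx) (negPf yx) F0.
Qed.

Lemma sum2_gproj V W x y v w (T : vectType k) (F : gT -> gT -> V -> W -> T) :
  v \in gpart V x -> w \in gpart W y ->
  (forall x' y' w', F x' y' 0 w' = 0) -> (forall x' y' v', F x' y' v' 0 = 0) ->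
  \sum_x' \sum_y' F x' y' (gproj V x' v) (gproj W y' w) = F x y v w.
Proof.
move=> vx wy F0l F0r.
rewrite (sum1_gproj (F := fun x' v' => \sum_y' F x' y' v' (gproj W y' w)) vx).
  exact: (sum1_gproj (F := fun y' w' => F x y' v w')).
by move=> x'; rewrite big1.
Qed.

Lemma sum3_gproj U V W x y z u v w (T : vectType k)
    (F : gT -> gT -> gT -> U -> V -> W -> T) :
  u \in gpart U x -> v \in gpart V y -> w \in gpart W z ->
  (forall x' y' z' v' w', F x' y' z' 0 v' w' = 0) ->
  (forall x' y' z' u' w', F x' y' z' u' 0 w' = 0) ->
  (forall x' y' z' u' v', F x' y' z' u' v' 0 = 0) ->
  \sum_x' \sum_y' \sum_z' F x' y' z' (gproj U x' u) (gproj V y' v) (gproj W z' w) =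
    F x y z u v w.
Proof.
move=> ux vy wz F0l F0m F0r.
rewrite (sum1_gproj (F := fun x' u' =>
  \sum_y' \sum_z' F x' y' z' u' (gproj V y' v) (gproj W z' w)) ux).
  exact: (sum2_gproj (F := fun y' z' => F x y' z' u)).
by move=> x'; rewrite big1 // => y' _; rewrite big1.
Qed.

Lemma assoc_lfE c U V W x y z u v w :
  u \in gpart U x -> v \in gpart V y -> w \in gpart W z ->
  assoc_lf c U V W (tens (tens u v) w : tensv (tensv U V) W) =
    c x y z *: (tens u (tens v w) : tensv U (tensv V W)).
Proof.
move=> ux vy wz; rewrite tlift_tens; last first.
  split=> [w'|t]; first exact: lin_fun.
  apply: lin_tlift => u' v'; do 3!apply: lin_sumf => ?; apply: lin_scalef.
  by move=> a r s; rewrite linearP !(tens_bilin _ _).2.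
rewrite tlift_tens; last first.
  split=> q; do 3!apply: lin_sumf => ?; apply: lin_scalef => a r s.
    by rewrite linearP (tens_bilin _ _).1.
  by rewrite linearP (tens_bilin _ _).1 (tens_bilin _ _).2.
apply: (sum3_gproj (F := fun x' y' z' u' v' w' => c x' y' z' *: tens u' (tens v' w')))
  => // *; by rewrite ?tens0l ?tens0r ?scaler0.
Qed.

Lemma assoc_inv_lfE c U V W x y z u v w :
  u \in gpart U x -> v \in gpart V y -> w \in gpart W z ->
  assoc_inv_lf c U V W (tens u (tens v w) : tensv U (tensv V W)) =
    c x y z *: (tens (tens u v) w : tensv (tensv U V) W).
Proof.
move=> ux vy wz; rewrite tlift_tens; last first.
  split=> [t|u']; last exact: lin_fun.
  apply: lin_tlift => v' w'; do 3!apply: lin_sumf => ?; apply: lin_scalef.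
  by move=> a r s; rewrite linearP !(tens_bilin _ _).1.
rewrite tlift_tens; last first.
  split=> q; do 3!apply: lin_sumf => ?; apply: lin_scalef => a r s.
    by rewrite linearP (tens_bilin _ _).2 (tens_bilin _ _).1.
  by rewrite linearP (tens_bilin _ _).2.
apply: (sum3_gproj (F := fun x' y' z' u' v' w' => c x' y' z' *: tens (tens u' v') w'))
  => // *; by rewrite ?tens0l ?tens0r ?tens0l ?scaler0.
Qed.

Lemma braid_lfE r V W x y v w : v \in gpart V x -> w \in gpart W y ->
  braid_lf r V W (tens v w : tensv V W) = r x y *: (tens w v : tensv W V).
Proof.
move=> vx wy; rewrite tlift_tens; last first.
  split=> q; do 2!apply: lin_sumf => ?; apply: lin_scalef => a s t.
    by rewrite linearP (tens_bilin _ _).2.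
  by rewrite linearP (tens_bilin _ _).1.
apply: (sum2_gproj (F := fun x' y' v' w' => r x' y' *: tens w' v'))
  => // *; by rewrite ?tens0l ?tens0r ?scaler0.
Qed.

Lemma lunit_lfE V (c : k^o) v : lunit_lf V (tens c v : tensv k^o V) = c *: v.
Proof.
rewrite tlift_tens //; split=> [w a c1 c2|c1 a w1 w2].
  by rewrite scalerDl scalerA.
by rewrite scalerDr !scalerA mulrC.
Qed.

Lemma runit_lfE V (c : k^o) v : runit_lf V (tens v c : tensv V k^o) = c *: v.
Proof.
rewrite tlift_tens //; split=> [c1 a w1 w2|w a c1 c2].
  by rewrite scalerDr !scalerA mulrC.
by rewrite scalerDl scalerA.
Qed.

Lemma assoc_subproof c U V W :
  assoc_lf c U V W \in gpred (gtens (gtens U V) W) (gtens U (gtens V W)).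
Proof.
apply: gpred_tens => xy z t w tg wz; move: t tg.
apply: gtpart_mem; first exact: (lin_comp (@lin_fun _ _ _) (@lin_tensl _ _ _)).
move=> x y u v <- ux vy; rewrite (assoc_lfE _ ux vy wz) memvZ // -mulgA.
by rewrite !(mem_gtpart (W := gtens V W)) ?mem_gtpart.
Qed.

Lemma assoc_inv_subproof c U V W :
  assoc_inv_lf c U V W \in gpred (gtens U (gtens V W)) (gtens (gtens U V) W).
Proof.
apply: gpred_tens => x yz u t ux; move: t.
apply: gtpart_mem; first exact: (lin_comp (@lin_fun _ _ _) (@lin_tensr _ _ _)).
move=> y z v w <- vy wz; rewrite (assoc_inv_lfE _ ux vy wz) memvZ // mulgA.
by rewrite !(mem_gtpart (V := gtens U V)) ?mem_gtpart.
Qed.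

Definition gassoc c U V W : ghom (gtens (gtens U V) W) (gtens U (gtens V W)) :=
  GHom (assoc_subproof c U V W).
Definition gassoc_inv c U V W : ghom (gtens U (gtens V W)) (gtens (gtens U V) W) :=
  GHom (assoc_inv_subproof (fun x y z => (c x y z)^-1) U V W).

Lemma lunit_subproof V : lunit_lf V \in gpred (gtens gunit V) V.
Proof.
apply: gpred_tens => x y c v /gunit_deg[->|->] vy.
  by rewrite lunit_lfE scale0r mem0v.
by rewrite lunit_lfE mul1g memvZ.
Qed.

Lemma runit_subproof V : runit_lf V \in gpred (gtens V gunit) V.
Proof.
apply: gpred_tens => x y v c vx /gunit_deg[->|->].
  by rewrite runit_lfE scale0r mem0v.
by rewrite runit_lfE mulg1 memvZ.
Qed.

Definition glunit V : ghom (gtens gunit V) V := GHom (lunit_subproof V).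
Definition grunit V : ghom (gtens V gunit) V := GHom (runit_subproof V).

Lemma lunit_inv_subproof V :
  linfun (fun v : V => tens (1 : k^o) v : tensv k^o V) \in gpred V (gtens gunit V).
Proof.
apply/gpredP => x v vx; rewrite (linfunE (@lin_tensr _ _ _)) -[x]mul1g.
by apply: (mem_gtpart (V := gunit)) => //; rewrite /= /gupart eqxx memvf.
Qed.

Lemma runit_inv_subproof V :
  linfun (fun v : V => tens v (1 : k^o) : tensv V k^o) \in gpred V (gtens V gunit).
Proof.
apply/gpredP => x v vx; rewrite (linfunE (@lin_tensl _ _ _)) -[x]mulg1.
by apply: (mem_gtpart (W := gunit)) => //; rewrite /= /gupart eqxx memvf.
Qed.

Lemma gthom_linear_l V V' W W' (g : ghom W W') : linear (fun f : ghom V V' => gthom f g).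
Proof.
move=> a f f'; apply: ghom_inj; apply: ext2 => x y v w _ _.
by rewrite glinE !gthomE glinE (tens_bilin _ _).1.
Qed.

Lemma gthom_linear_r V V' W W' (f : ghom V V') : linear (fun g : ghom W W' => gthom f g).
Proof.
move=> a g g'; apply: ghom_inj; apply: ext2 => x y v w _ _.
by rewrite glinE !gthomE glinE (tens_bilin _ _).2.
Qed.

Lemma gthom_id V W : gthom (gid V) (gid W) = gid (gtens V W).
Proof.
by apply: ghom_inj; apply: ext2 => x y v w _ _; rewrite gthomE !gidE.
Qed.

Lemma gthom_comp V V' V'' W W' W''
    (f' : ghom V' V'') (f : ghom V V') (g' : ghom W' W'') (g : ghom W W') :
  gthom (gcomp f' f) (gcomp g' g) = gcomp (gthom f' g') (gthom f g).
Proof.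
apply: ghom_inj; apply: ext2 => x y v w _ _.
by rewrite gcompE !gthomE !gcompE.
Qed.

Lemma ghomZ V W (f : ghom V W) c v : f (c *: v) = c *: f v.
Proof. exact: linearZ. Qed.

Lemma gassocE c U V W x y z u v w :
  u \in gpart U x -> v \in gpart V y -> w \in gpart W z ->
  gassoc c U V W (tens (tens u v) w : tensv (tensv U V) W) =
    c x y z *: (tens u (tens v w) : tensv U (tensv V W)).
Proof. exact: assoc_lfE. Qed.

Lemma gassoc_invE c U V W x y z u v w :
  u \in gpart U x -> v \in gpart V y -> w \in gpart W z ->
  gassoc_inv c U V W (tens u (tens v w) : tensv U (tensv V W)) =
    (c x y z)^-1 *: (tens (tens u v) w : tensv (tensv U V) W).
Proof. exact: (assoc_inv_lfE (fun x y z => (c x y z)^-1)). Qed.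

Lemma glunitE V (c : k^o) v : glunit V (tens c v : tensv k^o V) = c *: v.
Proof. exact: lunit_lfE. Qed.

Lemma grunitE V (c : k^o) v : grunit V (tens v c : tensv V k^o) = c *: v.
Proof. exact: runit_lfE. Qed.

Lemma gassoc_natural c U U' V V' W W' (f : ghom U U') (g : ghom V V') (h : ghom W W') :
  gcomp (gassoc c U' V' W') (gthom (gthom f g) h) =
  gcomp (gthom f (gthom g h)) (gassoc c U V W).
Proof.
apply: ghom_inj; apply: ext3 => x y z u v w ux vy wz.
rewrite !gcompE (gassocE _ ux vy wz) ghomZ !gthomE.
by rewrite (gassocE _ (ghom_mem f ux) (ghom_mem g vy) (ghom_mem h wz)).
Qed.

Section Cocycle.
Variable Phi : cocycle3.

Lemma gassocK U V W : gcomp (gassoc_inv Phi U V W) (gassoc Phi U V W) = gid _.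
Proof.
apply: ghom_inj; apply: ext3 => x y z u v w ux vy wz.
rewrite gcompE (gassocE _ ux vy wz) ghomZ.
by rewrite (gassoc_invE Phi ux vy wz) scalerA divff ?cocycle3_neq0 // scale1r gidE.
Qed.

Lemma gassoc_invK U V W : gcomp (gassoc Phi U V W) (gassoc_inv Phi U V W) = gid _.
Proof.
apply: ghom_inj; apply: ext3r => x y z u v w ux vy wz.
rewrite gcompE (gassoc_invE _ ux vy wz) ghomZ.
by rewrite (gassocE _ ux vy wz) scalerA mulVf ?cocycle3_neq0 // scale1r gidE.
Qed.

Lemma glunit_iso V : @is_iso k gcat (gtens gunit V) V (glunit V).
Proof.
exists (GHom (lunit_inv_subproof V)); split; apply: ghom_inj.
  apply: ext2 => x y c v _ _; rewrite gcompE glunitE gidE /= linearZ /=.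
  rewrite (linfunE (@lin_tensr _ _ _)).
  by rewrite -tensZl; congr tens; apply: mulr1.
by move=> v; rewrite gcompE gidE /= (linfunE (@lin_tensr _ _ _)) lunit_lfE scale1r.
Qed.

Lemma grunit_iso V : @is_iso k gcat (gtens V gunit) V (grunit V).
Proof.
exists (GHom (runit_inv_subproof V)); split; apply: ghom_inj.
  apply: ext2 => x y v c _ _; rewrite gcompE grunitE gidE /= linearZ /=.
  rewrite (linfunE (@lin_tensl _ _ _)).
  by rewrite -tensZr; congr tens; apply: mulr1.
by move=> v; rewrite gcompE gidE /= (linfunE (@lin_tensl _ _ _)) runit_lfE scale1r.
Qed.

Lemma glunit_natural V W (f : ghom V W) :
  gcomp (glunit W) (gthom (gid gunit) f) = gcomp f (glunit V).
Proof.
apply: ghom_inj; apply: ext2 => x y c v _ _.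
by rewrite !gcompE gthomE !glunitE gidE ghomZ.
Qed.

Lemma grunit_natural V W (f : ghom V W) :
  gcomp (grunit W) (gthom f (gid gunit)) = gcomp f (grunit V).
Proof.
apply: ghom_inj; apply: ext2 => x y v c _ _.
by rewrite !gcompE gthomE !grunitE gidE ghomZ.
Qed.

Lemma gtriangle V W :
  gcomp (gthom (gid V) (glunit W)) (gassoc Phi V gunit W) = gthom (grunit V) (gid W).
Proof.
apply: ghom_inj; apply: ext3 => x y z v c w vx cy wz.
rewrite gcompE (gassocE _ vx cy wz) ghomZ !gthomE !gidE glunitE grunitE.
rewrite tensZl tensZr.
case: (gunit_deg cy) => [->|->]; last by rewrite cocycle3_1m scale1r.
by rewrite !scale0r scaler0.
Qed.

Lemma gpentagon U V W X :
  gcomp (gcomp (gthom (gid U) (gassoc Phi V W X)) (gassoc Phi U (gtens V W) X))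
    (gthom (gassoc Phi U V W) (gid X)) =
  gcomp (gassoc Phi U V (gtens W X)) (gassoc Phi (gtens U V) W X).
Proof.
apply: ghom_inj; apply: ext4 => x y z t u v w s ux vy wz st.
rewrite !gcompE gthomE (gassocE _ ux vy wz) gidE.
rewrite (@tensZl _ (gtens U (gtens V W)) X) !ghomZ.
rewrite (gassocE (V := gtens V W) Phi ux (mem_gtpart vy wz) st) ghomZ gthomE gidE.
rewrite (gassocE Phi vy wz st) (@tensZr _ U (gtens V (gtens W X))).
rewrite (gassocE (U := gtens U V) Phi (mem_gtpart ux vy) wz st) ghomZ.
rewrite (gassocE (W := gtens W X) Phi ux vy (mem_gtpart wz st)) !scalerA.
by rewrite -cocycle3E; congr (_ *: _); rewrite mulrC mulrA mulrAC mulrC !mulrA mulrAC.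
Qed.

Definition VecG : moncat k :=
  @MonCat k gcat gtens gthom gunit (gassoc Phi) (gassoc_inv Phi) glunit grunit
    gthom_linear_l gthom_linear_r gthom_id gthom_comp (gassoc_natural Phi)
    gassocK gassoc_invK glunit_iso glunit_natural grunit_iso grunit_natural
    gtriangle gpentagon.

Hypothesis abG : abelian [set: gT].
Variable R : quasibichar Phi.

Lemma braid_subproof (r : gT -> gT -> k) V W :
  braid_lf r V W \in gpred (gtens V W) (gtens W V).
Proof.
apply: gpred_tens => x y v w vx wy; rewrite (braid_lfE _ vx wy) memvZ //.
have -> : (x * y)%g = (y * x)%g by apply: (centsP abG); rewrite inE.
exact: mem_gtpart.
Qed.

Definition gbraid r V W : ghom (gtens V W) (gtens W V) := GHom (braid_subproof r V W).

Lemma gbraidE r V W x y v w : v \in gpart V x -> w \in gpart W y ->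
  gbraid r V W (tens v w : tensv V W) = r x y *: (tens w v : tensv W V).
Proof. exact: braid_lfE. Qed.

Lemma gbraid_iso V W : @is_iso k gcat _ _ (gbraid R V W).
Proof.
exists (gbraid (fun x y => (R y x)^-1) W V).
split; apply: ghom_inj; apply: ext2 => x y v w vx wy;
rewrite gcompE (gbraidE _ vx wy) ghomZ (gbraidE _ wy vx) scalerA gidE.
  by rewrite divff ?quasibichar_neq0 // scale1r.
by rewrite mulVf ?quasibichar_neq0 // scale1r.
Qed.

Lemma gbraid_natural V V' W W' (f : ghom V V') (g : ghom W W') :
  gcomp (gbraid R V' W') (gthom f g) = gcomp (gthom g f) (gbraid R V W).
Proof.
apply: ghom_inj; apply: ext2 => x y v w vx wy; rewrite !gcompE gthomE.
rewrite (gbraidE _ vx wy) ghomZ gthomE.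
by rewrite (gbraidE _ (ghom_mem f vx) (ghom_mem g wy)).
Qed.

Lemma ghexagon1 U V W :
  gcomp (gcomp (gassoc Phi V W U) (gbraid R U (gtens V W))) (gassoc Phi U V W) =
  gcomp (gcomp (gthom (gid V) (gbraid R U W)) (gassoc Phi V U W))
    (gthom (gbraid R U V) (gid W)).
Proof.
apply: ghom_inj; apply: ext3 => x y z u v w ux vy wz.
rewrite !gcompE (gassocE _ ux vy wz) !ghomZ.
rewrite (gbraidE (W := gtens V W) R ux (mem_gtpart vy wz)) ghomZ.
rewrite (gassocE _ vy wz ux) gthomE (gbraidE R ux vy) gidE.
rewrite (@tensZl _ (gtens V U)) ghomZ (gassocE _ vy ux wz) !ghomZ.
rewrite gthomE gidE (gbraidE R ux wz) (@tensZr _ _ (gtens W U)) !scalerA.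
congr (_ *: _); rewrite quasibicharMr.
have := cocycle3_neq0 Phi y z x; have := cocycle3_neq0 Phi x y z.
move: (Phi x y z) (Phi y z x) (Phi y x z) (R x y) (R x z) => p q s r r' p0 q0.
by field; rewrite p0 q0.
Qed.

Lemma ghexagon2 U V W :
  gcomp (gcomp (gassoc_inv Phi W U V) (gbraid R (gtens U V) W)) (gassoc_inv Phi U V W) =
  gcomp (gcomp (gthom (gbraid R U W) (gid V)) (gassoc_inv Phi U W V))
    (gthom (gid U) (gbraid R V W)).
Proof.
apply: ghom_inj; apply: ext3r => x y z u v w ux vy wz.
rewrite !gcompE (gassoc_invE _ ux vy wz) !ghomZ.
rewrite (gbraidE (V := gtens U V) R (mem_gtpart ux vy) wz) ghomZ.
rewrite (gassoc_invE _ wz ux vy) gthomE (gbraidE R vy wz) gidE.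
rewrite (@tensZr _ _ (gtens W V)) ghomZ (gassoc_invE _ ux wz vy) !ghomZ.
rewrite gthomE gidE (gbraidE R ux wz) (@tensZl _ (gtens W U)) !scalerA.
congr (_ *: _); rewrite quasibicharMl.
have := cocycle3_neq0 Phi x y z; have := cocycle3_neq0 Phi z x y.
have := cocycle3_neq0 Phi x z y.
move: (Phi x y z) (Phi z x y) (Phi x z y) (R y z) (R x z) => p q s r r' s0 q0 p0.
by field; rewrite p0 q0 s0.
Qed.

Definition VecGR : brcat k :=
  @BrCat k VecG (gbraid R) gbraid_iso gbraid_natural ghexagon1 ghexagon2.

End Cocycle.

End Graded.

Section Standard.
Local Open Scope nat_scope.

(* Z_m is the additive group of residues 0, ..., m - 1 (for m > 0), read
   multiplicatively: the group law of ['I_m.-1.+1] is addition modulo m, and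
   [i : 'I_m.-1.+1] stands for the i-th power of the generator. *)
Definition ZxZ (m n : nat) : finGroupType := ('I_m.-1.+1 * 'I_n.-1.+1)%type.

Definition gen1 m n : ZxZ m n := (inZp 1, 1%g).
Definition gen2 m n : ZxZ m n := (1%g, inZp 1).

Definition exp1 m n (x : ZxZ m n) : nat := x.1.
Definition exp2 m n (x : ZxZ m n) : nat := x.2.

Record roots_of_unity (k : fieldType) := RootsOfUnity {
  zeta :> nat -> k;
  zetaP : forall s, 0 < s -> s.-primitive_root (zeta s)
}.

Variables (k : fieldType) (z : roots_of_unity k) (m n : nat).
Variables (a : 'I_m) (b : 'I_(gcdn m n)) (d : 'I_n).
Local Notation G := (ZxZ m n).

Lemma gen_exp (x : G) : x = (gen1 m n ^+ exp1 x * gen2 m n ^+ exp2 x)%g.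
Proof.
have expE p (i : 'I_p.+1) : i = (inZp 1 ^+ i)%g.
  by apply: val_inj; rewrite /= Zp_expg /= modnMml mul1n modn_small.
have exp1E e : (gen1 m n ^+ e = (inZp 1 ^+ e, 1))%g.
  by elim: e => // e IH; rewrite !expgS IH; congr pair; rewrite /= mulg1.
have exp2E e : (gen2 m n ^+ e = (1, inZp 1 ^+ e))%g.
  by elim: e => // e IH; rewrite !expgS IH; congr pair; rewrite /= mulg1.
rewrite exp1E exp2E; case: x => i j; congr pair; first by rewrite /= mulg1 -expE.
by rewrite /= mul1g -expE.
Qed.

Lemma ZxZ_abelian : abelian [set: G].
Proof.
by apply/centsP => x _ y _; congr pair; apply: val_inj; rewrite /= addnC.
Qed.

Lemma m_gt0 : 0 < m. Proof. exact: leq_ltn_trans (leq0n _) (ltn_ord a). Qed.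
Lemma n_gt0 : 0 < n. Proof. exact: leq_ltn_trans (leq0n _) (ltn_ord d). Qed.

Lemma exp1_lt (x : G) : exp1 x < m.
Proof. by rewrite -[X in _ < X](prednK m_gt0); apply: ltn_ord. Qed.

Lemma exp2_lt (x : G) : exp2 x < n.
Proof. by rewrite -[X in _ < X](prednK n_gt0); apply: ltn_ord. Qed.

Lemma exp1_1 : exp1 (1%g : G) = 0. Proof. by []. Qed.
Lemma exp2_1 : exp2 (1%g : G) = 0. Proof. by []. Qed.

Lemma exp1M (x y : G) : exp1 (x * y)%g = (exp1 x + exp1 y) %% m.
Proof. by rewrite -[X in _ %% X](prednK m_gt0). Qed.

Lemma exp2M (x y : G) : exp2 (x * y)%g = (exp2 x + exp2 y) %% n.
Proof. by rewrite -[X in _ %% X](prednK n_gt0). Qed.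

Lemma zeta_neq0 s e : 0 < s -> (z s ^+ e != 0)%R.
Proof.
move=> s_gt0; rewrite expf_neq0 //; apply/eqP => z0.
have := prim_expr_order (zetaP z s_gt0); rewrite z0 expr0n.
by rewrite gtn_eqF //= => /eqP; rewrite eq_sym oner_eq0.
Qed.

Lemma carryE p x y t : 0 < p -> (t + (x + y) %% p) %/ p + (x + y) %/ p = (t + (x + y)) %/ p.
Proof.
by move=> p_gt0; rewrite {3}(divn_eq (x + y) p) addnCA divnMDl // addnC.
Qed.

Lemma carry_cocycle (u : k) p q c i j y w t : 0 < p -> (u ^+ q = 1)%R ->
  (u ^+ (c * ((t + w) %/ p) * j) * u ^+ (c * ((t + (y + w) %% p) %/ p) * i)
     * u ^+ (c * ((w + y) %/ p) * i) =
   u ^+ (c * ((t + w) %/ p) * ((i + j) %% q))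
     * u ^+ (c * (((w + t) %% p + y) %/ p) * i))%R.
Proof.
move=> p_gt0 uq.
have um N M : (u ^+ (N * (M %% q)) = u ^+ (N * M))%R.
  by rewrite mulnC exprM expr_mod // -exprM mulnC.
rewrite um -!exprD {um}.
congr (_ ^+ _)%R.
have E : (t + (y + w) %% p) %/ p + (w + y) %/ p = (t + w) %/ p + ((w + t) %% p + y) %/ p.
  rewrite [w + y]addnC carryE // [(w + t) %% p + y]addnC [t + w]addnC addnC.
  by rewrite [RHS]addnC carryE // [w + t]addnC addnCA addnA [y + w + t]addnC addnA.
move: E; move: (_ %/ p) (_ %/ p) (_ %/ p) (_ %/ p) => C1 C2 C3 C4 E.
transitivity (c * C2 * j + c * (C4 + C3) * i); first by ring.
by rewrite E; ring.
Qed.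

Lemma mul3_eq (a1 a2 a3 a4 a5 b1 b2 b3 b4 b5 d1 d2 d3 d4 d5 : k) :
  (a1 * a2 * a3 = a4 * a5 -> b1 * b2 * b3 = b4 * b5 -> d1 * d2 * d3 = d4 * d5 ->
   (a1 * b1 * d1) * (a2 * b2 * d2) * (a3 * b3 * d3) = (a4 * b4 * d4) * (a5 * b5 * d5))%R.
Proof.
move=> A B D; transitivity ((a1 * a2 * a3) * (b1 * b2 * b3) * (d1 * d2 * d3))%R.
  by ring.
by rewrite A B D; ring.
Qed.

Definition PhiABD_fun (x y w : G) : k :=
  (z m ^+ (a * ((exp1 w + exp1 y) %/ m) * exp1 x)
   * z n ^+ (b * ((exp1 w + exp1 y) %/ m) * exp2 x)
   * z n ^+ (d * ((exp2 w + exp2 y) %/ n) * exp2 x))%R.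

Lemma PhiABD_neq0 x y w : (PhiABD_fun x y w != 0)%R.
Proof.
by rewrite !mulf_neq0 ?zeta_neq0 ?m_gt0 ?n_gt0.
Qed.

Lemma PhiABD_cocycle x y w t :
  (PhiABD_fun y w t * PhiABD_fun x (y * w)%g t * PhiABD_fun x y w =
   PhiABD_fun (x * y)%g w t * PhiABD_fun x y (w * t)%g)%R.
Proof.
have zm : (z m ^+ m = 1)%R by apply: prim_expr_order; apply: zetaP m_gt0.
have zn : (z n ^+ n = 1)%R by apply: prim_expr_order; apply: zetaP n_gt0.
have A := carry_cocycle a (exp1 x) (exp1 y) (exp1 y) (exp1 w) (exp1 t) m_gt0 zm.
have B := carry_cocycle b (exp2 x) (exp2 y) (exp1 y) (exp1 w) (exp1 t) m_gt0 zn.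
have D := carry_cocycle d (exp2 x) (exp2 y) (exp2 y) (exp2 w) (exp2 t) n_gt0 zn.
rewrite /PhiABD_fun !exp1M !exp2M.
exact: mul3_eq.
Qed.

Lemma PhiABD_1l y w : PhiABD_fun 1%g y w = 1%R.
Proof.
by rewrite /PhiABD_fun exp1_1 exp2_1 !muln0 !expr0 !mulr1.
Qed.

Lemma PhiABD_1m x w : PhiABD_fun x 1%g w = 1%R.
Proof.
rewrite /PhiABD_fun exp1_1 exp2_1 !addn0.
by rewrite !divn_small ?exp1_lt ?exp2_lt // !muln0 !expr0 !mulr1.
Qed.

Lemma PhiABD_1r x y : PhiABD_fun x y 1%g = 1%R.
Proof.
rewrite /PhiABD_fun exp1_1 exp2_1 !add0n.
by rewrite !divn_small ?exp1_lt ?exp2_lt // !muln0 !expr0 !mulr1.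
Qed.

Definition PhiABD : cocycle3 k G :=
  Cocycle3 PhiABD_neq0 PhiABD_cocycle PhiABD_1l PhiABD_1m PhiABD_1r.

Record Aabd := mkAabd {
  r11 : k; r12 : k; r21 : k; r22 : k;
  Aabd_neq0 : [&& r11 != 0, r12 != 0, r21 != 0 & r22 != 0]%R;
  Aabd_r11 : (r11 ^+ m = z m ^+ a /\ z m ^+ a = z m ^- a)%R;
  Aabd_r22 : (r22 ^+ n = z n ^+ d /\ z n ^+ d = z n ^- d)%R;
  Aabd_r12 : (r12 ^+ n = 1 /\ r12 ^+ m = z n ^- b)%R;
  Aabd_r21 : (r21 ^+ n = 1 /\ r21 ^+ m = z n ^+ b)%R
}.

Variable r : Aabd.

Definition Rr_fun (x y : G) : k :=
  (r11 r ^+ (exp1 x * exp1 y) * r12 r ^+ (exp1 x * exp2 y)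
   * r21 r ^+ (exp2 x * exp1 y) * r22 r ^+ (exp2 x * exp2 y))%R.

Lemma PhiABD_sym x y w : PhiABD x y w = PhiABD x w y.
Proof. by rewrite /= /PhiABD_fun [exp1 w + _]addnC [exp2 w + _]addnC. Qed.

Lemma exp_carry (s u : k) p i j t : u != 0%R -> (s ^+ p = u^-1)%R ->
  (s ^+ (((i + j) %% p) * t) = s ^+ (i * t) * s ^+ (j * t) * u ^+ (((i + j) %/ p) * t))%R.
Proof.
move=> u0 sp; rewrite -exprD -mulnDl {2}(divn_eq (i + j) p) mulnDl exprD.
rewrite [_ * p]mulnC -[p * _ * t]mulnA [in RHS]exprM sp exprVn mulrAC mulVf ?mul1r //.
exact: expf_neq0.
Qed.

Lemma exp_carry_r (s u : k) p i j t : u != 0%R -> (s ^+ p = u^-1)%R ->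
  (s ^+ (t * ((i + j) %% p)) = s ^+ (t * i) * s ^+ (t * j) * u ^+ (((i + j) %/ p) * t))%R.
Proof. by rewrite ![t * _]mulnC; apply: exp_carry. Qed.

Lemma mul11_eq (a1 a2 a3 b1 b2 b3 c1 c2 d1 d2 d3 : k) :
  ((a1 * a2 * a3) * (b1 * b2 * b3) * (c1 * c2 * 1) * (d1 * d2 * d3) =
   (a1 * b1 * c1 * d1) * (a2 * b2 * c2 * d2) * (a3 * b3 * d3))%R.
Proof. by ring. Qed.

Lemma mul11V_eq (a1 a2 a3 b1 b2 c1 c2 c3 d1 d2 d3 : k) :
  ((a1 * a2 * a3^-1) * (b1 * b2 * 1) * (c1 * c2 * c3^-1) * (d1 * d2 * d3^-1) =
   (a1 * b1 * c1 * d1) * (a2 * b2 * c2 * d2) * (a3 * c3 * d3)^-1)%R.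
Proof. by rewrite !invfM; ring. Qed.

Lemma Rr_neq0 x y : (Rr_fun x y != 0)%R.
Proof.
by case/and4P: (Aabd_neq0 r) => *; rewrite !mulf_neq0 ?expf_neq0.
Qed.

Lemma Rr_Ml x y w : Rr_fun (x * y)%g w =
  (Rr_fun x w * Rr_fun y w * (PhiABD w x y * PhiABD x y w / PhiABD x w y))%R.
Proof.
have [z11 zz11] := Aabd_r11 r; have [z22 zz22] := Aabd_r22 r.
have [u12 z12] := Aabd_r12 r; have [u21 z21] := Aabd_r21 r.
rewrite (PhiABD_sym x w y) mulfK ?PhiABD_neq0 // /= /PhiABD_fun /Rr_fun exp1M exp2M.
rewrite (exp_carry _ _ _ (zeta_neq0 a m_gt0)) ?z11 //.
rewrite (exp_carry _ _ _ (zeta_neq0 b n_gt0) z12).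
rewrite (exp_carry _ _ _ (oner_neq0 _)) ?invr1 //.
rewrite (exp_carry _ _ _ (zeta_neq0 d n_gt0)) ?z22 //.
rewrite expr1n -!exprM !mulnA.
rewrite [exp1 y + _]addnC [exp2 y + _]addnC; exact: mul11_eq.
Qed.

Lemma Rr_Mr x y w : Rr_fun x (y * w)%g =
  (Rr_fun x y * Rr_fun x w * (PhiABD y x w / (PhiABD y w x * PhiABD x y w)))%R.
Proof.
have [z11 zz11] := Aabd_r11 r; have [z22 zz22] := Aabd_r22 r.
have [u12 z12] := Aabd_r12 r; have [u21 z21] := Aabd_r21 r.
have nzV c p : 0 < p -> (z p ^- c != 0)%R by move=> p_gt0; rewrite invr_neq0 ?zeta_neq0.
rewrite (PhiABD_sym y x w) invfM [(PhiABD y w x * (_ * _))%R]mulrA divff ?PhiABD_neq0 // mul1r.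
rewrite /= /PhiABD_fun /Rr_fun exp1M exp2M.
rewrite (exp_carry_r _ _ _ (nzV a _ m_gt0)) ?invrK //.
rewrite (exp_carry_r _ _ _ (oner_neq0 _)) ?invr1 //.
rewrite (exp_carry_r _ _ _ (nzV b _ n_gt0)) ?invrK //.
rewrite (exp_carry_r _ _ _ (nzV d _ n_gt0)) ?invrK //.
rewrite expr1n !exprVn -!exprM !mulnA.
rewrite [exp1 w + _]addnC [exp2 w + _]addnC; exact: mul11V_eq.
Qed.

Definition Rr : quasibichar PhiABD := QuasiBichar Rr_neq0 Rr_Ml Rr_Mr.

End Standard.

(* Main.v *)
Require Import Defs.
From mathcomp Require Import all_boot all_order all_fingroup all_algebra.
From mathcomp Require Import ring.

(* Pull (Phi, R) back along NN^2 -> Z_m x Z_n. On the free commutative monoid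
   NN^2 every normalized 3-cocycle is the coboundary of an explicit 2-cochain J,
   and J twists R into a bimultiplicative B on NN^2; a free parameter of J makes
   B(e2, e1) = 1. If K = m e1 or K = n e2, then K maps to 1, which forces
   B(x, K) B(K, x) = B(K, K) = 1, whence the equations defining A_{a,0,d}, and
   J(u, v), J(u + K, v), J(u, v + K) differ only by B(u, K) and by the 2-coboundary
   of a function lam with lam(w + K) = lam(w) J(K, w). Corrected by lam, J becomes
   periodic in u and quasi-periodic in v; restricted to the exponents 0 <= i < m,
   0 <= j < n it is a 2-cochain on Z_m x Z_n that carries (Phi, R) to
   (Phi_{a,0,d}, R_r), since each carry in the second argument costs a factor
   B(u, K). This cochain is the monoidal structure of a braided equivalence whose
   underlying functor is the identity. *)

Set Implicit Arguments.
Unset Strict Implicit.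
Unset Printing Implicit Defensive.
Import GroupScope GRing.Theory.
Local Open Scope ring_scope.
Local Open Scope cat_scope.

(** * Braided equivalences carried by the identity functor and a 2-cochain *)

Section Twist.
Variables (k : fieldType) (gT : finGroupType) (abG : abelian [set: gT]).
Variables (Phi Phi' : cocycle3 k gT) (R : quasibichar Phi) (R' : quasibichar Phi').
Variable J : gT -> gT -> k.
Hypothesis J_neq0 : forall x y, J x y != 0.
Hypothesis J1l : forall x, J 1%g x = 1.
Hypothesis J1r : forall x, J x 1%g = 1.
Hypothesis J_assoc : forall x y z,
  Phi x y z * J (x * y)%g z * J x y = J x (y * z)%g * J y z * Phi' x y z.
Hypothesis J_braid : forall x y, R x y * J x y = J y x * R' x y.

Let C := VecGR abG R.
Let D := VecGR abG R'.

(* Composing two braidings yields the map v (x) w |-> c x y . v (x) w; the lock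
   keeps [gcompE] from seeing through it. *)
Definition gscale (c : gT -> gT -> k) (V W : grspace k gT) :
    ghom (gtens V W) (gtens V W) :=
  locked (gcomp (gbraid abG (fun _ _ => 1) W V) (gbraid abG c V W)).

Lemma gscaleE c V W x y v w : v \in gpart V x -> w \in gpart W y ->
  gscale c V W (tens v w : tensv V W) = c x y *: (tens v w : tensv V W).
Proof.
move=> vx wy; rewrite /gscale -lock gcompE (gbraidE _ _ vx wy) ghomZ (gbraidE _ _ wy vx).
by rewrite scale1r.
Qed.

Definition id_functor : functor C D :=
  @Functor k C D (fun X => X) (fun X Y f => f) (fun X Y a f g => erefl)
    (fun X => erefl) (fun X Y Z g f => erefl).

Lemma gscale_iso V W : @is_iso k (gcat k gT) _ _ (gscale J V W).
Proof.
exists (gscale (fun x y => (J x y)^-1) V W).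
split; apply: ghom_inj; apply: ext2 => x y v w vx wy;
  rewrite gcompE (gscaleE _ vx wy) ghomZ (gscaleE _ vx wy) scalerA gidE.
  by rewrite divff // scale1r.
by rewrite mulVf // scale1r.
Qed.

Lemma gid_iso V : @is_iso k (gcat k gT) _ _ (gid V).
Proof. by exists (gid V); split; apply: gcomp_idl. Qed.

Lemma gscale_natural V V' W W' (f : ghom V V') (g : ghom W W') :
  gcomp (gscale J V' W') (gthom f g) = gcomp (gthom f g) (gscale J V W).
Proof.
apply: ghom_inj; apply: ext2 => x y v w vx wy; rewrite !gcompE gthomE.
rewrite (gscaleE _ vx wy) ghomZ gthomE.
by rewrite (gscaleE _ (ghom_mem f vx) (ghom_mem g wy)).
Qed.

(** Both sides scale a homogeneous tensor, and [J_assoc] equates the two scalars. *)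
Lemma gscale_assoc U V W :
  gcomp (gcomp (gassoc Phi U V W) (gscale J (gtens U V) W))
    (gthom (gscale J U V) (gid W)) =
  gcomp (gcomp (gscale J U (gtens V W)) (gthom (gid U) (gscale J V W)))
    (gassoc Phi' U V W).
Proof.
apply: ghom_inj; apply: ext3 => x y z u v w ux vy wz.
rewrite !gcompE (gassocE _ ux vy wz) gthomE (gscaleE _ ux vy) gidE.
rewrite !ghomZ gthomE (gscaleE _ vy wz) gidE.
rewrite (@tensZl _ (gtens U V)) ghomZ (gscaleE (V := gtens U V) _ (mem_gtpart ux vy) wz).
rewrite !ghomZ (gassocE _ ux vy wz).
rewrite (@tensZr _ _ (gtens V W)) ghomZ (gscaleE (W := gtens V W) _ ux (mem_gtpart vy wz)).
rewrite !scalerA; congr (_ *: _).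
transitivity (Phi x y z * J (x * y)%g z * J x y); first by ring.
by rewrite J_assoc; ring.
Qed.

Lemma gscale_lunit V :
  gcomp (gcomp (glunit V) (gscale J (gunit k gT) V)) (gthom (gid (gunit k gT)) (gid V)) =
  glunit V.
Proof.
apply: ghom_inj; apply: ext2 => x y c v cx vy.
rewrite !gcompE gthomE !gidE (gscaleE _ cx vy) ghomZ.
(* A homogeneous element of the unit object is zero or of degree 1, where [J] is normalized. *)
case: (gunit_deg cx) => [->|->]; last by rewrite J1l scale1r.
by rewrite glunitE scale0r scaler0.
Qed.

Lemma gscale_runit V :
  gcomp (gcomp (grunit V) (gscale J V (gunit k gT))) (gthom (gid V) (gid (gunit k gT))) =
  grunit V.
Proof.
apply: ghom_inj; apply: ext2 => x y v c vx cy.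
rewrite !gcompE gthomE !gidE (gscaleE _ vx cy) ghomZ.
case: (gunit_deg cy) => [->|->]; last by rewrite J1r scale1r.
by rewrite grunitE scale0r scaler0.
Qed.

Definition twist_functor : monfunctor C D :=
  @MonFunctor k C D id_functor (gscale J) (gid (gunit k gT))
    gscale_iso (gid_iso _) gscale_natural gscale_assoc gscale_lunit gscale_runit.

Lemma gscale_braid V W :
  gcomp (gbraid abG R V W) (gscale J V W) = gcomp (gscale J W V) (gbraid abG R' V W).
Proof.
apply: ghom_inj; apply: ext2 => x y v w vx wy.
rewrite !gcompE (gscaleE _ vx wy) (gbraidE _ _ vx wy) !ghomZ.
by rewrite (gbraidE _ _ vx wy) (gscaleE _ wy vx) !scalerA mulrC J_braid mulrC.
Qed.

Lemma twist_braided : is_braided twist_functor.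
Proof. exact: gscale_braid. Qed.

Lemma twist_equivalence : is_equivalence twist_functor.
Proof.
exists (@Functor k D C (fun X => X) (fun X Y f => f) (fun X Y a f g => erefl)
    (fun X => erefl) (fun X Y Z g f => erefl)).
split; exists (@gid k gT); split; do ?exact: gid_iso.
  by move=> X Y f; rewrite [LHS]gcomp_idl [RHS]gcomp_idr.
by move=> X Y f; rewrite [LHS]gcomp_idl [RHS]gcomp_idr.
Qed.

Lemma twist_braided_equivalent : braided_equivalent C D.
Proof. by exists twist_functor; split; [apply: twist_braided | apply: twist_equivalence]. Qed.

End Twist.

(** * Cocycles and coboundaries on a commutative monoid *)

Section MonoidCocycle.
Variables (k : fieldType) (V : nmodType) (P : V -> V -> V -> k).

Definition cocycle_on : Prop :=
  forall x y z w, P y z w * P x (y + z) w * P x y z = P (x + y) z w * P x y (z + w).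

Definition trivialized_by (J : V -> V -> k) : Prop :=
  forall x y z, P x y z * J (x + y) z * J x y = J x (y + z) * J y z.

(** [P] times the coboundary of [J]: again a cocycle, and constantly 1 exactly when [J] trivializes
    [P]. *)
Definition twist3 (J : V -> V -> k) x y z : k :=
  P x y z * J (x + y) z * J x y / (J x (y + z) * J y z).

Lemma twist3_cocycle J : (forall x y, J x y != 0) -> cocycle_on ->
  forall x y z w, twist3 J y z w * twist3 J x (y + z) w * twist3 J x y z =
    twist3 J (x + y) z w * twist3 J x y (z + w).
Proof.
move=> J0 PC x y z w; rewrite /twist3.
transitivity ((P y z w * P x (y + z) w * P x y z) * (J (x + (y + z)) w * J (x + y) z * J x y)
    / (J x (y + z + w) * J y (z + w) * J z w)).
  by field; rewrite !J0.
by rewrite PC !addrA; field; rewrite !J0.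
Qed.

Lemma twist3_trivialized J : (forall x y, J x y != 0) ->
  (forall x y z, twist3 J x y z = 1) -> trivialized_by J.
Proof.
move=> J0 H x y z; have D0 : J x (y + z) * J y z != 0 by rewrite mulf_neq0.
by have := H x y z; rewrite /twist3 => /(canRL (divfK D0)); rewrite mul1r.
Qed.

End MonoidCocycle.

(** * Triviality of 3-cocycles on the free commutative monoid of rank 2 *)

Section Nat2.
Local Notation V := (nat * nat)%type.
Variables (k : fieldType) (P : V -> V -> V -> k).
Hypothesis P_neq0 : forall x y z, P x y z != 0.
Hypothesis P_cocycle : cocycle_on P.
Hypothesis P1l : forall y z, P 0 y z = 1.
Hypothesis P1m : forall x z, P x 0 z = 1.
Hypothesis P1r : forall x y, P x y 0 = 1.

Local Notation e1 := ((1, 0)%N : V).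
Local Notation e2 := ((0, 1)%N : V).

Lemma nat2_addE i j s t : (i, j) + (s, t) = ((i + s)%N, (j + t)%N) :> V.
Proof. by []. Qed.

Lemma nat2_ind (Q : V -> Prop) : Q 0 -> (forall i, Q (i, 0)%N -> Q ((i, 0)%N + e1)) ->
  (forall v, Q v -> Q (v + e2)) -> forall v, Q v.
Proof.
move=> Q0 Q1 Q2 [i j]; elim: j => [|j /Q2]; last by rewrite nat2_addE addn0 addn1.
by elim: i => // i /Q1; rewrite nat2_addE addn1.
Qed.

(** The cocycle identity with a generator as last argument propagates the value 1 from the
    generators to every third argument. *)
Lemma twist3_nat2_trivial (Q : V -> V -> V -> k) :
  cocycle_on Q -> (forall x y, Q x y 0 = 1) ->
  (forall x y, Q x y e2 = 1) -> (forall x i, Q x (i, 0)%N e1 = 1) ->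
  (forall x, Q x e2 e1 = 1) -> forall x y z, Q x y z = 1.
Proof.
move=> QC Q1 Qe2 Qe1 Qe21.
have QDe2 x y z : Q x y (z + e2) = Q x y z.
  by have := QC x y z e2; rewrite !Qe2 !mul1r.
(* By the identity at (x, y, e2, e1), [Q x (y + e2) e1] is [Q x y (e2 + e1)]; commutativity and
   [QDe2] bring this back to [Q x y e1]. *)
have Qye1 x y : Q x y e1 = 1.
  elim/nat2_ind: y => [|i _|y IH]; [exact: (Qe1 x 0)|by rewrite nat2_addE|].
  have := QC x y e2 e1; rewrite !Qe21 Qe2 mulr1 !mul1r => ->.
  by rewrite addrC QDe2.
move=> x y z; elim/nat2_ind: z => [|i IH|z IH]; first exact: Q1.
  by have := QC x y (i, 0)%N e1; rewrite !Qye1 !mul1r => <-.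
by rewrite QDe2.
Qed.

Variable c : k.
Hypothesis c_neq0 : c != 0.

(* [nat2_prim x e1 = nat2_prim1 x] and [nat2_prim x e2 = 1]; the remaining values
   are forced by [twist3 P nat2_prim x v e = 1] when the generator e extends the
   word e1 ... e1 e2 ... e2 of v, and [nat2_prim1] is chosen so that this also
   holds for v = e2 and e = e1. *)
Definition nat2_prim1 (v : V) : k :=
  \prod_(t < v.2) (c * P (v.1, t : nat) e1 e2 / P (v.1, t : nat) e2 e1).

Definition nat2_prim (x v : V) : k :=
  \prod_(s < v.1) (P x (s : nat, 0%N) e1 * nat2_prim1 (x + (s : nat, 0%N))) *
  \prod_(t < v.2) P x (v.1, t : nat) e2.

Lemma nat2_prim1_neq0 v : nat2_prim1 v != 0.
Proof. by apply/prodf_neq0 => t _; rewrite !mulf_neq0 ?invr_neq0. Qed.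

Lemma nat2_prim_neq0 x v : nat2_prim x v != 0.
Proof.
by rewrite mulf_neq0 //; apply/prodf_neq0 => t _; rewrite ?mulf_neq0 ?nat2_prim1_neq0.
Qed.

Lemma nat2_prim1_0 i : nat2_prim1 (i, 0%N) = 1.
Proof. exact: big_ord0. Qed.

Lemma nat2_prim1De2 v : nat2_prim1 (v + e2) = nat2_prim1 v * (c * P v e1 e2 / P v e2 e1).
Proof. by case: v => i j; rewrite nat2_addE addn0 addn1 /nat2_prim1 /= big_ord_recr. Qed.

Lemma nat2_primDe2 x v : nat2_prim x (v + e2) = nat2_prim x v * P x v e2.
Proof. by case: v => i j; rewrite nat2_addE addn0 addn1 /nat2_prim /= big_ord_recr /= mulrA. Qed.

Lemma nat2_primDe1 x i : nat2_prim x ((i, 0%N) + e1) =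
  nat2_prim x (i, 0%N) * (P x (i, 0%N) e1 * nat2_prim1 (x + (i, 0%N))).
Proof. by rewrite nat2_addE addn0 addn1 /nat2_prim /= !big_ord0 !mulr1 big_ord_recr. Qed.

Lemma nat2_prim_0 x : nat2_prim x 0 = 1.
Proof. by rewrite /nat2_prim !big_ord0 mulr1. Qed.

Lemma nat2_prim_e1 x : nat2_prim x e1 = nat2_prim1 x.
Proof. by have := nat2_primDe1 x 0; rewrite add0r nat2_prim_0 mul1r P1m mul1r addr0. Qed.

Lemma nat2_prim_e2 x : nat2_prim x e2 = 1.
Proof. by have := nat2_primDe2 x 0; rewrite add0r nat2_prim_0 mul1r P1m. Qed.

Lemma nat2_prim_e2_e1 : nat2_prim e2 e1 = c.
Proof. by rewrite nat2_prim_e1 -[e2]add0r nat2_prim1De2 nat2_prim1_0 !P1l mul1r mulr1 divr1. Qed.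

Lemma nat2_prim_trivializes : trivialized_by P nat2_prim.
Proof.
apply: (twist3_trivialized nat2_prim_neq0).
apply: twist3_nat2_trivial.
- exact/twist3_cocycle/P_cocycle/nat2_prim_neq0.
- by move=> x y; rewrite /twist3 P1r !nat2_prim_0 addr0; field; rewrite nat2_prim_neq0.
- move=> x y; rewrite /twist3 !nat2_prim_e2 nat2_primDe2.
  by field; rewrite P_neq0 nat2_prim_neq0.
- move=> x i; rewrite /twist3 !nat2_prim_e1 nat2_primDe1 nat2_prim1_0.
  by field; rewrite P_neq0 nat2_prim_neq0 nat2_prim1_neq0.
(* Passing from x to x + e2 multiplies [nat2_prim1] by exactly the factor that is needed here. *)
- move=> x; rewrite /twist3 nat2_prim_e2_e1 nat2_prim_e2 !nat2_prim_e1.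
  rewrite [e2 + e1]addrC nat2_primDe2 nat2_prim_e1.
  by rewrite nat2_prim1De2; field; rewrite !P_neq0 c_neq0 nat2_prim1_neq0.
Qed.

End Nat2.

(** * Pullback of a braided structure along a monoid morphism, and its behaviour on the kernel *)

Section Pullback.
Variables (k : fieldType) (gT : finGroupType) (V : nmodType) (pi : V -> gT).
Hypothesis piD : forall x y, pi (x + y) = (pi x * pi y)%g.
Variables (Phi : cocycle3 k gT) (R : quasibichar Phi).

Definition pull3 (x y z : V) : k := Phi (pi x) (pi y) (pi z).

Lemma pull3_cocycle : cocycle_on pull3.
Proof. by move=> x y z w; rewrite /pull3 !piD cocycle3E. Qed.

Lemma quasibichar1r x : R x 1%g = 1.
Proof.
apply: (mulfI (quasibichar_neq0 R x 1%g)).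
have := quasibicharMr R x 1%g 1%g.
by rewrite mulg1 !(cocycle3_1l, cocycle3_1m, cocycle3_1r) !mulr1 divff ?oner_eq0 // mulr1.
Qed.

Lemma quasibichar1l x : R 1%g x = 1.
Proof.
apply: (mulfI (quasibichar_neq0 R 1%g x)).
have := quasibicharMl R 1%g 1%g x.
by rewrite mulg1 !(cocycle3_1l, cocycle3_1m, cocycle3_1r) !mulr1 divff ?oner_eq0 // mulr1.
Qed.

Variable J : V -> V -> k.
Hypothesis J_neq0 : forall x y, J x y != 0.
Hypothesis J_triv : trivialized_by pull3 J.

(** The braiding after twisting by [J]: the associator becomes trivial, so the hexagons become
    bimultiplicativity. *)
Definition tbichar (x y : V) : k := R (pi x) (pi y) * J x y / J y x.

Lemma tbichar_neq0 x y : tbichar x y != 0.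
Proof. by rewrite !mulf_neq0 ?invr_neq0 ?quasibichar_neq0. Qed.

Lemma pull3_trivE x y z :
  Phi (pi x) (pi y) (pi z) = J x (y + z) * J y z / (J (x + y) z * J x y).
Proof. by rewrite -J_triv -(mulrA (pull3 x y z)) mulfK ?mulf_neq0. Qed.

Lemma tbicharDl x y z : tbichar (x + y) z = tbichar x z * tbichar y z.
Proof.
rewrite /tbichar piD quasibicharMl !pull3_trivE [x + z]addrC [y + z]addrC.
by field; rewrite !J_neq0.
Qed.

Lemma tbicharDr x y z : tbichar x (y + z) = tbichar x y * tbichar x z.
Proof.
rewrite /tbichar piD quasibicharMr !pull3_trivE [z + x]addrC [x + y]addrC.
by field; rewrite !J_neq0.
Qed.

Lemma tbichar0r x : tbichar x 0 = 1.
Proof. by apply: (mulfI (tbichar_neq0 x 0)); rewrite -tbicharDr addr0 mulr1. Qed.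

Lemma tbichar0l x : tbichar 0 x = 1.
Proof. by apply: (mulfI (tbichar_neq0 0 x)); rewrite -tbicharDl addr0 mulr1. Qed.

Lemma tbicharMnl x y i : tbichar (x *+ i) y = tbichar x y ^+ i.
Proof. by elim: i => [|i IH]; rewrite ?tbichar0l // mulrS tbicharDl IH exprS. Qed.

Lemma tbicharMnr x y i : tbichar x (y *+ i) = tbichar x y ^+ i.
Proof. by elim: i => [|i IH]; rewrite ?tbichar0r // mulrS tbicharDr IH exprS. Qed.

Lemma tbichar_kerr K x : pi K = 1%g -> tbichar x K = J x K / J K x.
Proof. by move=> piK; rewrite /tbichar piK quasibichar1r mul1r. Qed.

Lemma tbichar_kerl K x : pi K = 1%g -> tbichar K x = J K x / J x K.
Proof. by move=> piK; rewrite /tbichar piK quasibichar1l mul1r. Qed.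

Lemma tbichar_ker_anti K x : pi K = 1%g -> tbichar x K * tbichar K x = 1.
Proof. by move=> piK; rewrite tbichar_kerr // tbichar_kerl //; field; rewrite !J_neq0. Qed.

Lemma tbichar_ker_diag K : pi K = 1%g -> tbichar K K = 1.
Proof. by move=> piK; rewrite tbichar_kerr // divff. Qed.

Lemma triv_kerl K u v : pi K = 1%g -> J (K + u) v = J u v * J K (u + v) / J K u.
Proof.
move=> piK; have := J_triv K u v; rewrite /pull3 piK cocycle3_1l mul1r => E.
by apply: (mulIf (J_neq0 K u)); rewrite E divfK // mulrC.
Qed.

(** Solve the trivialization at (u, v, K), then exchange the arguments of [J (u + v) K] and [J v K]
    by [tbichar]; multiplicativity leaves only [tbichar u K]. *)
Lemma triv_kerr K u v : pi K = 1%g ->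
  J u (v + K) = tbichar u K * J u v * J K (u + v) / J K v.
Proof.
move=> piK; have := J_triv u v K; rewrite /pull3 piK cocycle3_1r mul1r => E.
have JK x : J x K = tbichar x K * J K x by rewrite tbichar_kerr // divfK.
rewrite (canRL (mulfK (J_neq0 v K)) (esym E)) !JK tbicharDl.
by field; rewrite !J_neq0 tbichar_neq0.
Qed.

(** The compatibility that allows one [lam] to satisfy the recurrences for both K and L. *)
Lemma triv_ker_comm K L w : pi K = 1%g -> pi L = 1%g -> tbichar L K = 1 ->
  J K w * J L (w + K) = J L w * J K (w + L).
Proof.
move=> piK piL LK; rewrite (triv_kerr _ _ piK) LK [L + w]addrC.
by field; rewrite J_neq0.
Qed.

Variable lam : V -> k.
Hypothesis lam_neq0 : forall w, lam w != 0.

Definition lam_twist u v : k := J u v * (lam u * lam v / lam (u + v)).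

Lemma lam_twist_neq0 u v : lam_twist u v != 0.
Proof. by rewrite mulf_neq0 ?mulf_neq0 ?invr_neq0. Qed.

Lemma lam_twist_triv : trivialized_by pull3 lam_twist.
Proof.
move=> x y z; rewrite /pull3 pull3_trivE /lam_twist addrA.
by field; rewrite !J_neq0 !lam_neq0.
Qed.

(** The coboundary of [lam] is symmetric, so correcting by it leaves [tbichar] unchanged. *)
Lemma lam_twist_sym x y : R (pi x) (pi y) * lam_twist x y = lam_twist y x * tbichar x y.
Proof.
rewrite /lam_twist /tbichar [y + x]addrC.
by field; rewrite J_neq0 lam_neq0.
Qed.

(** The factor [J K (u + v) / J K u] from [triv_kerl] cancels against the change of the coboundary
    of [lam]. *)
Lemma lam_twist_kerl K u v : pi K = 1%g -> (forall w, lam (w + K) = lam w * J K w) ->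
  lam_twist (u + K) v = lam_twist u v.
Proof.
move=> piK lamK; rewrite /lam_twist lamK addrAC lamK [u + K]addrC triv_kerl //.
by field; rewrite !J_neq0 lam_neq0.
Qed.

Lemma lam_twist_kerr K u v : pi K = 1%g -> (forall w, lam (w + K) = lam w * J K w) ->
  lam_twist u (v + K) = tbichar u K * lam_twist u v.
Proof.
move=> piK lamK; rewrite /lam_twist lamK addrA lamK triv_kerr //.
by field; rewrite !J_neq0 lam_neq0.
Qed.

Lemma lam_twist_kerlMn K u v e : pi K = 1%g -> (forall w, lam (w + K) = lam w * J K w) ->
  lam_twist (u + K *+ e) v = lam_twist u v.
Proof.
move=> piK lamK; elim: e => [|e IH]; first by rewrite addr0.
by rewrite mulrSr addrA lam_twist_kerl.
Qed.

Lemma lam_twist_kerrMn K u v e : pi K = 1%g -> (forall w, lam (w + K) = lam w * J K w) ->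
  lam_twist u (v + K *+ e) = tbichar u K ^+ e * lam_twist u v.
Proof.
move=> piK lamK; elim: e => [|e IH]; first by rewrite addr0 mul1r.
by rewrite mulrSr addrA lam_twist_kerr // IH exprS mulrA.
Qed.

End Pullback.

(** * Solving two compatible multiplicative recurrences on the quarter plane *)

Section QuasiPeriodic.
Local Notation V := (nat * nat)%type.
Variables (k : fieldType) (m n : nat) (p q : V -> k).
Hypotheses (m_gt0 : (0 < m)%N) (n_gt0 : (0 < n)%N).
Hypotheses (p_neq0 : forall w, p w != 0) (q_neq0 : forall w, q w != 0).
Hypothesis pq : forall w : V,
  p w * q (w + (m, 0%N)) = q w * p (w + (0%N, n)).

Lemma quasi_periodic : exists lam : V -> k,
  [/\ forall w, lam w != 0, lam 0 = 1,
      forall w, lam (w + (m, 0%N)) = lam w * p w &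
      forall w, lam (w + (0%N, n)) = lam w * q w].
Proof.
(* Start with 1 at the residues of w, climb by steps of n, then go right by steps of m. The
   horizontal recurrence is immediate. *)
pose lam (w : V) := \prod_(s < w.1 %/ m) p ((w.1 %% m + s * m)%N, w.2) *
  \prod_(t < w.2 %/ n) q ((w.1 %% m)%N, (w.2 %% n + t * n)%N).
have lamm w : lam (w + (m, 0%N)) = lam w * p w.
  case: w => i j; rewrite nat2_addE addn0 /lam /= divnDr // divnn m_gt0 addn1.
  rewrite modnDr big_ord_recr /= mulrAC; congr (_ * p (_, _)); rewrite addnC.
  by rewrite -divn_eq.
exists lam; split=> // [w||[i j]].
- by rewrite mulf_neq0 //; apply/prodf_neq0.
- by rewrite /lam /= !div0n !big_ord0 mulr1.
(* The vertical recurrence holds by construction in the columns below m; [pq] carries it m columns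
   to the right. *)
rewrite (divn_eq i m); elim: (i %/ m)%N => [|s IH].
  rewrite mul0n add0n nat2_addE addn0 /lam /= divn_small ?ltn_pmod // !big_ord0 !mul1r.
  rewrite divnDr // divnn n_gt0 addn1 modnDr modn_mod big_ord_recr /=.
  by congr (_ * q (_, _)); rewrite addnC -divn_eq.
have -> : ((s.+1 * m + i %% m)%N, j) = ((s * m + i %% m)%N, j) + (m, 0%N).
  by rewrite nat2_addE addn0 mulSn; congr pair; rewrite [RHS]addnC addnA.
move: IH; set w := ((s * m + i %% m)%N, j) => IH.
rewrite (addrAC w) !lamm IH -!mulrA; congr (_ * _).
by rewrite pq.
Qed.

End QuasiPeriodic.

(** * The normal form on a product of two cyclic groups *)

Section CyclicProduct.
Local Notation V := (nat * nat)%type.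
Variables (m n : nat).
Local Notation G := (ZxZ m n).
Local Notation e1 := ((1, 0)%N : V).
Local Notation e2 := ((0, 1)%N : V).

Definition proj2 (v : V) : G := (inZp v.1, inZp v.2).

Definition lift2 (x : G) : V := (exp1 x, exp2 x).

Lemma proj2D u v : proj2 (u + v) = (proj2 u * proj2 v)%g.
Proof.
by case: u v => i j [s t]; rewrite nat2_addE; congr pair; apply: val_inj; rewrite /= modnDm.
Qed.

Lemma lift2K x : proj2 (lift2 x) = x.
Proof. by case: x => i j; congr pair; apply: val_inj; rewrite /= modn_small //; apply: ltn_ord. Qed.

Lemma proj2_e1 : proj2 e1 = gen1 m n.
Proof. by congr pair; apply: val_inj. Qed.

Lemma proj2_e2 : proj2 e2 = gen2 m n.
Proof. by congr pair; apply: val_inj. Qed.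

Lemma nat2_genE i j : e1 *+ i + e2 *+ j = (i, j) :> V.
Proof.
have -> : e1 *+ i = (i, 0%N) by elim: i => // i IH; rewrite mulrSr IH nat2_addE addn1.
have -> : e2 *+ j = (0%N, j) by elim: j => // j IH; rewrite mulrSr IH nat2_addE addn1.
by rewrite nat2_addE addn0.
Qed.

Hypotheses (m_gt0 : (0 < m)%N) (n_gt0 : (0 < n)%N).

Lemma proj2_m : proj2 (e1 *+ m) = 1%g.
Proof.
rewrite -[e1 *+ m]addr0 -[0]/(e2 *+ 0) nat2_genE.
by congr pair; apply: val_inj; rewrite /= ?mod0n // prednK // modnn.
Qed.

Lemma proj2_n : proj2 (e2 *+ n) = 1%g.
Proof.
rewrite -[e2 *+ n]add0r -[0]/(e1 *+ 0) nat2_genE.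
by congr pair; apply: val_inj; rewrite /= ?mod0n // prednK // modnn.
Qed.

(** Division with remainder; the multiples of the kernel elements are the carries in the exponents
    of [PhiABD]. *)
Lemma lift2D x y : lift2 x + lift2 y = lift2 (x * y)%g +
  e1 *+ m *+ ((exp1 x + exp1 y) %/ m) + e2 *+ n *+ ((exp2 x + exp2 y) %/ n).
Proof.
rewrite -addrA -!mulrnA nat2_genE /lift2 !nat2_addE.
rewrite (exp1M (Ordinal m_gt0)) (exp2M (Ordinal n_gt0)).
by congr pair; rewrite [RHS]addnC mulnC -divn_eq.
Qed.

Variables (k : fieldType) (z : roots_of_unity k).
Variables (Phi : cocycle3 k G) (R : quasibichar Phi).

Let P := pull3 proj2 Phi.
Let J := nat2_prim P (R (gen2 m n) (gen1 m n))^-1.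
Let B := tbichar proj2 R J.

Let P_neq0 u v w : P u v w != 0.
Proof. exact: cocycle3_neq0. Qed.

Let proj2_0 : proj2 0 = 1%g.
Proof. by congr pair; apply: val_inj. Qed.

Let P1l v w : P 0 v w = 1.
Proof. by rewrite /P /pull3 proj2_0 cocycle3_1l. Qed.

Let P1m v w : P v 0 w = 1.
Proof. by rewrite /P /pull3 proj2_0 cocycle3_1m. Qed.

Let P1r v w : P v w 0 = 1.
Proof. by rewrite /P /pull3 proj2_0 cocycle3_1r. Qed.

Let c_neq0 : (R (gen2 m n) (gen1 m n))^-1 != 0.
Proof. by rewrite invr_neq0 ?quasibichar_neq0. Qed.

Let J_neq0 u v : J u v != 0.
Proof. exact: nat2_prim_neq0. Qed.

Let J_triv : trivialized_by (pull3 proj2 Phi) J.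
Proof. exact/nat2_prim_trivializes/c_neq0/P1r/P1m/P1l/pull3_cocycle/proj2D. Qed.

Let J0r u : J u 0 = 1. Proof. exact: nat2_prim_0. Qed.

Let J0l u : J 0 u = 1.
Proof.
apply: (mulIf (J_neq0 0 u)); have := J_triv 0 0 u.
by rewrite /pull3 proj2_0 cocycle3_1l !add0r J0r mulr1.
Qed.

Let B21 : B e2 e1 = 1.
Proof.
(* The value of [J e2 e1] was prescribed for this. *)
rewrite /B /tbichar /J nat2_prim_e2_e1 // nat2_prim_e2 //.
by rewrite proj2_e1 proj2_e2 divr1 mulfV ?quasibichar_neq0.
Qed.

Let r11 := B e1 e1.
Let r12 := B e1 e2.
Let r22 := B e2 e2.

Let BDl := tbicharDl proj2D R J_neq0 J_triv.
Let BDr := tbicharDr proj2D R J_neq0 J_triv.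
Let BMnl := tbicharMnl proj2D R J_neq0 J_triv.
Let BMnr := tbicharMnr proj2D R J_neq0 J_triv.

Let BE i j s t : B (i, j) (s, t) =
  r11 ^+ (i * s) * r12 ^+ (i * t) * r22 ^+ (j * t).
Proof.
rewrite -(nat2_genE i) -(nat2_genE s) /B BDl !BDr !BMnl !BMnr -/B B21 !expr1n mul1r.
by rewrite -!exprM [(s * i)%N]mulnC [(t * i)%N]mulnC [(t * j)%N]mulnC.
Qed.

Let r12n : r12 ^+ n = 1.
Proof.
have := tbichar_ker_anti R J_neq0 e1 proj2_n.
by rewrite BMnl BMnr -/B B21 expr1n mulr1.
Qed.

(** Testing m e1 against e2, where [B21] kills the other factor; this is what permits b = 0. *)
Let r12m : r12 ^+ m = 1.
Proof.
have := tbichar_ker_anti R J_neq0 e2 proj2_m.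
by rewrite BMnl BMnr -/B B21 expr1n mul1r.
Qed.

Let r11mm : r11 ^+ m * r11 ^+ m = 1.
Proof. by have := tbichar_ker_anti R J_neq0 e1 proj2_m; rewrite BMnl BMnr. Qed.

Let r22nn : r22 ^+ n * r22 ^+ n = 1.
Proof. by have := tbichar_ker_anti R J_neq0 e2 proj2_n; rewrite BMnl BMnr. Qed.

(** This is B(K, K) = 1 for K = m e1; it makes [r11 ^+ m] a power of [z m], whose exponent will be
    a. *)
Let r11_root : (r11 ^+ m) ^+ m = 1.
Proof. by have := tbichar_ker_diag R J_neq0 proj2_m; rewrite BMnl BMnr. Qed.

Let r22_root : (r22 ^+ n) ^+ n = 1.
Proof. by have := tbichar_ker_diag R J_neq0 proj2_n; rewrite BMnl BMnr. Qed.

Lemma cyclic_product_normal_form :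
  exists (a : 'I_m) (b : 'I_(gcdn m n)) (d : 'I_n) (r : Aabd z a b d),
    braided_equivalent (VecGR (ZxZ_abelian m n) R) (VecGR (ZxZ_abelian m n) (Rr r)).
Proof.
have [a Ea] := prim_rootP (zetaP z m_gt0) r11_root.
have [d Ed] := prim_rootP (zetaP z n_gt0) r22_root.
have gcd_gt0 : (0 < gcdn m n)%N by rewrite gcdn_gt0 m_gt0.
have B_neq0 := tbichar_neq0 proj2 R J_neq0.
have nz : [&& r11 != 0, r12 != 0, 1 != 0 :> k & r22 != 0] by rewrite !B_neq0 oner_neq0.
have self_inv x (s : nat) i : x ^+ s = z s ^+ i -> x ^+ s * x ^+ s = 1 ->
    x ^+ s = z s ^+ i /\ z s ^+ i = z s ^- i.
  move=> E x2; split=> //; rewrite -E; exact/esym/mulr1_eq.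
(* [Ordinal gcd_gt0] is b = 0, and the entry r21 is 1 by [B21]. *)
pose r : Aabd z a (Ordinal gcd_gt0) d :=
  @mkAabd _ z m n a (Ordinal gcd_gt0) d _ _ _ _ nz (self_inv _ _ _ Ea r11mm)
  (self_inv _ _ _ Ed r22nn) (conj r12n (etrans r12m (esym (invr1 _))))
  (conj (expr1n _ _) (expr1n _ _)).
exists a, (Ordinal gcd_gt0), d, r.
have comm w : J (e1 *+ m) w * J (e2 *+ n) (w + e1 *+ m) =
    J (e2 *+ n) w * J (e1 *+ m) (w + e2 *+ n).
  apply: (triv_ker_comm proj2D (R := R) J_neq0 J_triv); [exact: proj2_m | exact: proj2_n |].
  by rewrite BMnl BMnr -/B B21 !expr1n.
have [lam [lam0 lam1 lamm lamn]] : exists lam : V -> k, [/\ forall w, lam w != 0, lam 0 = 1,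
    forall w, lam (w + e1 *+ m) = lam w * J (e1 *+ m) w &
    forall w, lam (w + e2 *+ n) = lam w * J (e2 *+ n) w].
  move: comm; rewrite -[e1 *+ m]addr0 -[0]/(e2 *+ 0) nat2_genE.
  rewrite -[e2 *+ n]add0r -[0]/(e1 *+ 0) nat2_genE.
  exact: quasi_periodic.
pose J' := lam_twist J lam.
have J'l u v i j : J' (u + e1 *+ m *+ i + e2 *+ n *+ j) v = J' u v.
  rewrite /J' (lam_twist_kerlMn J_neq0 J_triv lam0 _ _ _ proj2_n lamn).
  exact: (lam_twist_kerlMn J_neq0 J_triv lam0 _ _ _ proj2_m lamm).
(* Of B(u, m e1) and B(u, n e2) only powers of [r11] and [r22] survive, by [B21] and [r12n]. *)
have J'r u v i j : J' u (v + e1 *+ m *+ i + e2 *+ n *+ j) =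
    (r11 ^+ m) ^+ (i * u.1) * (r22 ^+ n) ^+ (j * u.2) * J' u v.
  rewrite /J' (lam_twist_kerrMn proj2D R J_neq0 J_triv lam0 _ _ _ proj2_n lamn).
  rewrite (lam_twist_kerrMn proj2D R J_neq0 J_triv lam0 _ _ _ proj2_m lamm) -/B.
  case: u => s t /=; rewrite /B BMnr BMnr -/B (BE s t 1 0) (BE s t 0 1).
  rewrite !muln0 !muln1 !expr0 !mulr1 !mul1r exprMn -(exprM r12) mulnC exprM r12n expr1n mul1r.
  rewrite mulrCA mulrA -!exprM; congr (_ ^+ _ * _ ^+ _ * _); ring.
apply: (@twist_braided_equivalent _ _ _ _ _ _ _ (fun x y => J' (lift2 x) (lift2 y))).
- by move=> x y; apply: lam_twist_neq0.
- by move=> x; rewrite /J' /lam_twist J0l lam1 add0r mul1r mul1r divff.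
- by move=> x; rewrite /J' /lam_twist J0r lam1 addr0 mulr1 mul1r divff.
(* The carries of x y disappear by [J'l]; those of y w produce [PhiABD] by [J'r]. *)
- move=> x y w.
  have := lam_twist_triv J_neq0 J_triv lam0 (lift2 x) (lift2 y) (lift2 w).
  rewrite -/J' /pull3 !lift2K (lift2D x y) J'l (lift2D y w) J'r Ea Ed => ->.
  rewrite /= /PhiABD_fun mul0n mulr1.
  rewrite [(exp1 w + _)%N]addnC [(exp2 w + _)%N]addnC -!exprM !mulnA.
  by rewrite -mulrA mulrC.
(* On the representatives, B is given by the formula of [Rr_fun]. *)
move=> x y; have := lam_twist_sym proj2 R J_neq0 lam0 (lift2 x) (lift2 y).
rewrite !lift2K -/J' -/B => ->; congr (_ * _).
by rewrite BE /= /Rr_fun /= expr1n mulr1.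
Qed.

End CyclicProduct.

Theorem theorem4p2 (k : closedFieldType) (char0 : [pchar k]%R =i pred0)
    (zeta : roots_of_unity k) (m n : nat) (m_pos : (0 < m)%N) (n_pos : (0 < n)%N)
    (Phi : cocycle3 k (ZxZ m n)) (R : quasibichar Phi) :
  exists (a : 'I_m) (b : 'I_(gcdn m n)) (d : 'I_n) (r : Aabd zeta a b d),
    braided_equivalent
      (VecGR (ZxZ_abelian m n) R)
      (VecGR (ZxZ_abelian m n) (Rr r)).
Proof. exact: cyclic_product_normal_form. Qed.
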